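(* Let $r_+^2>r_-^2$ with $r_+^2>0$, set $r_H^2=r_+^2$ and $N=(R-r_+^2)(R-r_-^2)$, and let $f,m,\varpi,a_0,a_\phi$ be functions of $R$ that are smooth in a neighbourhood of $R=r_H^2$, with $f=f^{(1)}(R-r_H^2)+O((R-r_H^2)^2)$ and $m=m^{(1)}(R-r_H^2)+O((R-r_H^2)^2)$, where $f^{(1)},m^{(1)}>0$. Let $g,A$ be the metric and potential of the context, defined for $R>r_H^2$ near $r_H^2$. Put $$\kappa=2f'(r_H^2)\sqrt{\frac{N'(r_H^2)}{m'(r_H^2)}},\qquad '=\frac{d}{dR},$$ and define $(U,V,\theta,\Phi,\Psi)$ by $$\frac{dU}{U}-\frac{dV}{V}=\kappa\,dt,\qquad \frac{dU}{U}+\frac{dV}{V}=\kappa\sqrt{\frac mN}\,\frac{dR}{2f},\qquad d\Phi=d\phi-\varpi(r_H^2)\,dt,\qquad d\Psi=d\psi-\varpi(r_H^2)\,dt .$$ Then, with a suitable choice of the integration constants, $UV=(R/r_H^2-1)\,h(R)$ with $h$ smooth near $r_H^2$ and $h(R)=1+O(R-r_H^2)$; the components of $g$ in the coordinates $(U,V,\theta,\Phi,\Psi)$ extend smoothly to a nondegenerate metric on a neighbourhood of the bifurcation sphere $U=V=0$, at which the future and past horizons $R=r_H^2$ intersect (nondegeneracy being understood away from the usual coordinate degeneracies $\theta=0,\pi/2$); and $A$ is the sum of an exact one-form and a one-form whose components in these coordinates extend smoothly to this neighbourhood.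
   Context: The ansatz, in coordinates $(t,R,\theta,\phi,\psi)$ with $R=r^2$, $0<\theta<\pi/2$, is $$ds^2=-f\,dt^2+\frac{m}{f}\Big(\frac{dR^2}{4N}+d\theta^2\Big)+\frac{N}{m}\Big[\sin^2\theta\,(d\phi-\varpi\,dt)^2+\cos^2\theta\,(d\psi-\varpi\,dt)^2\Big]+\frac{m^2-fN}{m f}\sin^2\theta\cos^2\theta\,(d\phi-d\psi)^2,$$ $$A=a_0\,dt+a_\phi(\sin^2\theta\,d\phi+\cos^2\theta\,d\psi),$$ where all of $f,m,N,\varpi,a_0,a_\phi$ are functions of $R$ only. *)

(* Defs.v *)
(* MathComp-Analysis; the reals are an arbitrary R : realType. *)
From HB Require Import structures.
From mathcomp Require Import all_boot all_order all_algebra.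
From mathcomp Require Import all_classical all_reals all_analysis.

Set Implicit Arguments.
Unset Strict Implicit.
Unset Printing Implicit Defensive.

Import Order.TTheory GRing.Theory Num.Theory.
Import numFieldNormedType.Exports.
Local Open Scope classical_set_scope.
Local Open Scope ring_scope.

(* n times differentiable (Frechet) on W, directional derivatives being taken
   in constant directions; used only with W open and V = R or V = R^5, where
   "for all n" is the usual C^oo. *)
Fixpoint n_times_differentiable (R : realType) (V : normedModType R)
    (n : nat) (W : set V) (F : V -> R) : Prop :=
  if n is n'.+1 then
    (forall p, W p -> differentiable F p) /\
    (forall v, n_times_differentiable n' W (fun p => 'D_v F p))
  else True.

Definition smooth_on (R : realType) (V : normedModType R)
    (W : set V) (F : V -> R) : Prop :=
  forall n, n_times_differentiable n W F.

Definition smooth_near (R : realType) (a : R) (F : R -> R) : Prop :=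
  exists W : set R, [/\ open W, W a & smooth_on W F].

(* Points of R^5 and tangent vectors at them are row vectors.  The old
   coordinates (t, R, theta, phi, psi) and the new ones
   (U, V, theta, Phi, Psi) use the same five indices. *)
Definition iT : 'I_5 := @Ordinal 5 0 isT.
Definition iR : 'I_5 := @Ordinal 5 1 isT.
Definition iTheta : 'I_5 := @Ordinal 5 2 isT.
Definition iphi : 'I_5 := @Ordinal 5 3 isT.
Definition ipsi : 'I_5 := @Ordinal 5 4 isT.
Definition iU : 'I_5 := @Ordinal 5 0 isT.
Definition iV : 'I_5 := @Ordinal 5 1 isT.
Definition iPhi : 'I_5 := @Ordinal 5 3 isT.
Definition iPsi : 'I_5 := @Ordinal 5 4 isT.

Definition vec5 (R : realType) (a b c d e : R) : 'rV[R]_5 :=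
  \row_(j < 5) [:: a; b; c; d; e]`_j.

(* The last two coordinates are angles of period 2 pi. *)
Definition angle_periodic (R : realType) (T : Type) (F : 'rV[R]_5 -> T) : Prop :=
  forall x, F (x + (2 * pi) *: delta_mx 0 iphi) = F x /\
            F (x + (2 * pi) *: delta_mx 0 ipsi) = F x.

Definition Nfun (R : realType) (rp2 rm2 : R) (r : R) : R :=
  (r - rp2) * (r - rm2).

(* ds^2 at x, as a quadratic form in the tangent vector v. *)
Definition ds2 (R : realType) (N f m varpi : R -> R) (x v : 'rV[R]_5) : R :=
  let r := x 0 iR in
  let s := sin (x 0 iTheta) in
  let c := cos (x 0 iTheta) in
  let dt := v 0 iT in let dR := v 0 iR in let dtheta := v 0 iTheta in
  let dphi := v 0 iphi in let dpsi := v 0 ipsi in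
  - f r * dt ^+ 2
  + m r / f r * (dR ^+ 2 / (4 * N r) + dtheta ^+ 2)
  + N r / m r * (s ^+ 2 * (dphi - varpi r * dt) ^+ 2
                 + c ^+ 2 * (dpsi - varpi r * dt) ^+ 2)
  + (m r ^+ 2 - f r * N r) / (m r * f r)
    * s ^+ 2 * c ^+ 2 * (dphi - dpsi) ^+ 2.

(* The one-form A at x, evaluated on v. *)
Definition potential (R : realType) (a0 aphi : R -> R) (x v : 'rV[R]_5) : R :=
  let r := x 0 iR in
  let s := sin (x 0 iTheta) in
  let c := cos (x 0 iTheta) in
  a0 r * v 0 iT + aphi r * (s ^+ 2 * v 0 iphi + c ^+ 2 * v 0 ipsi).

Definition kappa (R : realType) (rH2 : R) (N f m : R -> R) : R :=
  2 * derive1 f rH2 * Num.sqrt (derive1 N rH2 / derive1 m rH2).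

Definition exterior (R : realType) (rH2 eps : R) : set 'rV[R]_5 :=
  [set x | rH2 < x 0 iR < rH2 + eps /\ 0 < x 0 iTheta < pi / 2].

(* The change of coordinates (t, R, theta, phi, psi) |->
   (U, V, theta, Phi, Psi), and its differential at x. *)
Definition chart (R : realType) (U V Phi Psi : 'rV[R]_5 -> R) (x : 'rV[R]_5) :
    'rV[R]_5 :=
  vec5 (U x) (V x) (x 0 iTheta) (Phi x) (Psi x).

Definition dchart (R : realType) (U V Phi Psi : 'rV[R]_5 -> R)
    (x v : 'rV[R]_5) : 'rV[R]_5 :=
  vec5 ('d U x v) ('d V x v) (v 0 iTheta) ('d Phi x v) ('d Psi x v).

(* The differential equations defining the new coordinates.  The exterior is
   taken to be the quadrant U > 0, V > 0, in which t increases with U / V. *)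
Definition coordinate_equations (R : realType) (rH2 : R)
    (N f m varpi : R -> R) (D : set 'rV[R]_5) (U V Phi Psi : 'rV[R]_5 -> R) :
    Prop :=
  let k := kappa rH2 N f m in
  forall x, D x ->
    [/\ 0 < U x, 0 < V x & forall v : 'rV[R]_5,
    [/\ 'd U x v / U x - 'd V x v / V x = k * v 0 iT,
        'd U x v / U x + 'd V x v / V x =
          k * Num.sqrt (m (x 0 iR) / N (x 0 iR))
            * (v 0 iR / (2 * f (x 0 iR))),
        'd Phi x v = v 0 iphi - varpi rH2 * v 0 iT &
        'd Psi x v = v 0 ipsi - varpi rH2 * v 0 iT]].

(* A neighbourhood of U = V = 0 in (U, V, theta, Phi, Psi)-space.  The
   bifurcation locus being a compact 3-sphere, any neighbourhood of it contains
   one of this form.  theta is left free, so that smoothness on this set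
   includes smoothness of the components at theta = 0 and theta = pi / 2. *)
Definition bif_nbhd (R : realType) (delta : R) : set 'rV[R]_5 :=
  [set p | `|p 0 iU| < delta /\ `|p 0 iV| < delta].

Definition qform (R : realType) (G : 'M[R]_5) (w : 'rV[R]_5) : R :=
  (w *m G *m w^T) 0 0.

(* Points of the new coordinate space reached from the exterior D as
   R -> rH2 while t -> tlim: the future horizon for tlim = +oo, the past one
   for tlim = -oo. *)
Definition horizon (R : realType) (rH2 : R) (D : set 'rV[R]_5)
    (chi : 'rV[R]_5 -> 'rV[R]_5) (tlim : set_system R) : set 'rV[R]_5 :=
  [set p | exists x : nat -> 'rV[R]_5,
    [/\ forall n, D (x n),
        (fun n => x n 0 iT) @ \oo --> tlim,
        (fun n => x n 0 iR) @ \oo --> rH2 &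
        (fun n => chi (x n)) @ \oo --> p]].

(* The hypersurface on which the k-th coordinate is constant is null: the
   metric G is degenerate on its tangent space. *)
Definition null_coordinate_hypersurface (R : realType) (k : 'I_5)
    (G : 'M[R]_5) : Prop :=
  exists v : 'rV[R]_5, [/\ v != 0, v 0 k = 0 &
    forall w : 'rV[R]_5, w 0 k = 0 -> (v *m G *m w^T) 0 0 = 0].

(* On the neighbourhood W of U = V = 0, the locus R = rH2 consists of the null
   hypersurfaces U = 0 and V = 0; the future horizon lies on the latter, the
   past one on the former, and they meet at U = V = 0. *)
Definition horizons_meet_at_bifurcation (R : realType) (rH2 : R)
    (D W : set 'rV[R]_5) (chi : 'rV[R]_5 -> 'rV[R]_5)
    (G : 'rV[R]_5 -> 'M[R]_5) : Prop :=
  let future := horizon rH2 D chi (pinfty_nbhs R) in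
  let past := horizon rH2 D chi (ninfty_nbhs R) in
  (exists rext : 'rV[R]_5 -> R,
    [/\ smooth_on W rext, angle_periodic rext,
        forall x, D x -> W (chi x) -> rext (chi x) = x 0 iR &
        forall p, W p -> (rext p = rH2 <-> p 0 iU = 0 \/ p 0 iV = 0)]) /\
  (forall p, W p -> 0 <= p 0 iTheta <= pi / 2 ->
    [/\ future p <-> 0 <= p 0 iU /\ p 0 iV = 0,
        past p <-> p 0 iU = 0 /\ 0 <= p 0 iV &
        (future p /\ past p) <-> (p 0 iU = 0 /\ p 0 iV = 0)]) /\
  (forall p, W p ->
    (p 0 iU = 0 -> null_coordinate_hypersurface iU (G p)) /\
    (p 0 iV = 0 -> null_coordinate_hypersurface iV (G p))).

(* The components of g in the coordinates chi extend to the smooth components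
   G on W, symmetric, and nondegenerate away from theta = 0, pi / 2. *)
Definition metric_extends (R : realType) (g : 'rV[R]_5 -> 'rV[R]_5 -> R)
    (D W : set 'rV[R]_5) (chi : 'rV[R]_5 -> 'rV[R]_5)
    (dchi : 'rV[R]_5 -> 'rV[R]_5 -> 'rV[R]_5)
    (G : 'rV[R]_5 -> 'M[R]_5) : Prop :=
  [/\ forall i j, smooth_on W (fun p => G p i j),
      angle_periodic G,
      forall p, W p -> (G p)^T = G p,
      forall p, W p -> 0 < p 0 iTheta < pi / 2 -> \det (G p) != 0 &
      forall x v, D x -> W (chi x) -> g x v = qform (G (chi x)) (dchi x v)].

(* A = d lambda + B, the components of B in the coordinates chi extending
   smoothly to W. *)
Definition potential_extends_up_to_exact (R : realType)
    (A : 'rV[R]_5 -> 'rV[R]_5 -> R)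
    (D W : set 'rV[R]_5) (chi : 'rV[R]_5 -> 'rV[R]_5)
    (dchi : 'rV[R]_5 -> 'rV[R]_5 -> 'rV[R]_5) : Prop :=
  exists (lambda : 'rV[R]_5 -> R) (B : 'rV[R]_5 -> 'rV[R]_5),
    [/\ smooth_on D lambda, angle_periodic lambda,
        forall i, smooth_on W (fun p => B p 0 i), angle_periodic B &
        forall x v, D x -> W (chi x) ->
          A x v = 'd lambda x v + \sum_(i < 5) B (chi x) 0 i * dchi x v 0 i].

(* Main.v *)
(* Write a = r_H^2.  By Hadamard's lemma f = (R - a) F and m = (R - a) M with F
   and M smooth, and N = (R - a) (R - r_-^2).  Hence d log (UV) = q dR / (R - a)
   with q = (kappa / 2) sqrt (M / (R - r_-^2)) / F smooth, and kappa is exactly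
   the constant for which q(a) = 1.  So UV = (R / a - 1) h, where h is the
   exponential of a primitive of (q - 1) / (R - a), and R is a smooth function
   rho of UV by the inverse function theorem.  With
   tau = V dU - U dV = kappa UV dt one finds
     - f dt^2 + m dR^2 / (4 f N) = (4 a F / (kappa^2 h)) dU dV,
     dphi - varpi dt = dPhi - (a w / (kappa h)) tau,
     (m^2 - f N) / (m f) = M / F - (R - r_-^2) / M,
   where varpi = varpi(a) + (R - a) w, and all coefficients on the right are
   smooth functions of UV.  Subtracting from A the exact form c dt, with c the
   value of a_0 + a_phi varpi(a) at R = a, leaves a dt-component divisible by
   R - a, and (R - a) dt is a smooth multiple of tau. *)

Require Import Defs.
From HB Require Import structures.
From mathcomp Require Import all_boot all_order all_algebra.
From mathcomp Require Import all_classical all_reals all_analysis.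
From mathcomp Require Import ring lra.

Set Implicit Arguments.
Unset Strict Implicit.
Unset Printing Implicit Defensive.

Import Order.TTheory GRing.Theory Num.Theory.
Import numFieldNormedType.Exports.
Local Open Scope classical_set_scope.
Local Open Scope ring_scope.

(** * Calculus of smooth functions *)

Section LocalDifferentiability.
Context {R : realType} {V : normedModType R}.
Implicit Types F G : V -> R.

(** The zero linear map satisfies the first-order expansion at [x], with an error that vanishes near
    [x]; uniqueness identifies it with the differential. *)
Lemma near0_differentiable F (x : V) :
  (\near x, F x = 0) -> differentiable F x.
Proof.
move=> F0; have Fx0 : F x = 0 := nbhs_singleton F0.
have o0 : F \o shift x = cst (F x) + (\0 : {linear V -> R}) +o_ 0 id.
  apply/eqaddoP => e e0; have := F0; rewrite (near_shift 0 x).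
  apply: filterS => h /=; rewrite subr0 !fctE /= Fx0 addr0 subr0 => ->.
  by rewrite normr0 mulr_ge0// ltW.
have c0 : continuous (\0 : {linear V -> R}) by move=> y; exact: cvg_cst.
have dF := diff_unique c0 o0.
by apply/diff_locallyP; rewrite dF.
Qed.

(** Write [G = F + (G - F)], where the second summand vanishes near [x]. *)
Lemma near_eq_differentiable F G (x : V) :
  (\near x, F x = G x) -> differentiable F x -> differentiable G x.
Proof.
move=> FG dF; rewrite (_ : G = F + (G - F)); last by rewrite addrC subrK.
apply: differentiableD => //; apply: near0_differentiable.
by apply: filterS FG => y; rewrite !fctE => ->; rewrite subrr.
Qed.

End LocalDifferentiability.

(** * Closure properties of n-fold differentiability *)

Section SmoothCalculus.
Context {R : realType} {V : normedModType R}.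
Implicit Types (W : set V) (F G : V -> R).

Lemma ntd_pred n W F : n_times_differentiable n.+1 W F -> n_times_differentiable n W F.
Proof.
elim: n F => // n IH F [dF nF]; split => // v; exact: IH (nF v).
Qed.

Lemma ntd_eq n W F G : open W -> {in W, F =1 G} ->
  n_times_differentiable n W F -> n_times_differentiable n W G.
Proof.
move=> oW; elim: n F G => // n IH F G FG [dF nF].
have FGn p : W p -> \near p, F p = G p.
  move=> Wp; have : nbhs p W by apply: open_nbhs_nbhs; split.
  by apply: filterS => q Wq; apply: FG; rewrite inE.
split=> [p Wp|v]; first exact: near_eq_differentiable (FGn p Wp) (dF p Wp).
by apply: IH (nF v) => p /[1!inE] Wp; exact: near_eq_derive (FGn p Wp).
Qed.

Lemma ntd_sub n W1 W2 F : W1 `<=` W2 ->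
  n_times_differentiable n W2 F -> n_times_differentiable n W1 F.
Proof.
move=> W12; elim: n F => // n IH F [dF nF].
by split=> [p /W12|v]; [exact: dF|exact: IH (nF v)].
Qed.

Lemma ntd_cst n W (c : R) : n_times_differentiable n W (fun=> c).
Proof.
elim: n c => // n IH c; split=> [p _|v]; first exact: differentiable_cst.
have -> : (fun p => 'D_v (fun _ : V => c) p) = fun=> 0; last exact: IH.
by apply/funext => p; exact: derive_cst.
Qed.

Lemma ntd_linear n W (F : {linear V -> R}) :
  continuous F -> n_times_differentiable n W F.
Proof.
case: n => // n cF; split=> [p _|v]; first exact: linear_differentiable.
have -> : (fun p => 'D_v F p) = fun=> F v; last exact: ntd_cst.
by apply/funext => p; rewrite deriveE ?diff_lin//; exact: linear_differentiable.
Qed.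

Lemma ntdD n W F G : open W ->
  n_times_differentiable n W F -> n_times_differentiable n W G ->
  n_times_differentiable n W (fun p => F p + G p).
Proof.
move=> oW; elim: n F G => // n IH F G [dF nF] [dG nG].
split=> [p Wp|v]; first by apply: differentiableD; [exact: dF|exact: dG].
apply: ntd_eq (IH _ _ (nF v) (nG v)) => // p /[1!inE] Wp.
by rewrite -deriveD //; apply: diff_derivable; [exact: dF|exact: dG].
Qed.

Lemma ntdM n W F G : open W ->
  n_times_differentiable n W F -> n_times_differentiable n W G ->
  n_times_differentiable n W (fun p => F p * G p).
Proof.
move=> oW; elim: n F G => // n IH F G hF hG.
have [[dF nF] [dG nG]] := (hF, hG).
split=> [p Wp|v]; first by apply: differentiableM; [exact: dF|exact: dG].
(* Each term of the Leibniz rule keeps one factor undifferentiated; [ntd_pred] lowers that factor to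
   order [n]. *)
have := ntdD oW (IH _ _ (ntd_pred hF) (nG v)) (IH _ _ (ntd_pred hG) (nF v)).
apply: ntd_eq => // p /[1!inE] Wp.
by rewrite deriveM //; apply: diff_derivable; [exact: dF|exact: dG].
Qed.

End SmoothCalculus.

(** * Composition with functions of one real variable *)

Section SmoothComp.
Context {R : realType}.

Lemma derive_scale (F : R -> R) (x v : R) :
  differentiable F x -> 'D_v F x = v * 'D_1 F x.
Proof. by move=> dF; rewrite !deriveE// -{1}(mulr1 v) -[v * 1]/(v *: 1) linearZ. Qed.

Lemma ntd_comp n (V : normedModType R) (W : set V) (I : set R)
    (F : V -> R) (u : R -> R) :
  open W -> W `<=` F @^-1` I ->
  n_times_differentiable n W F -> n_times_differentiable n I u ->
  n_times_differentiable n W (u \o F).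
Proof.
move=> oW WI; elim: n u => // n IH u hF hu.
have [[dF nF] [du nu]] := (hF, hu).
split=> [p Wp|v].
  by apply: differentiable_comp; [exact: dF|exact/du/WI].
(* By the chain rule the derivative is the product of [u'] composed with [F] and ['D_v F]; the
   induction applies to [u'] in place of [u]. *)
apply: ntd_eq (ntdM oW (IH _ (ntd_pred hF) (nu 1)) (nF v)) => // p /[1!inE] Wp.
have dFp := dF p Wp; have dup := du _ (WI p Wp).
rewrite [RHS]deriveE; last exact: differentiable_comp.
by rewrite diff_comp//= -!deriveE// [RHS]derive_scale// mulrC.
Qed.

(** On the line every direction is a multiple of 1, so one derivative controls all directional ones.
    This is the bootstrap by which smoothness is read off a differential equation. *)
Lemma ntd1S n (I : set R) (u u' : R -> R) : open I ->
  (forall x, I x -> is_derive x 1 u (u' x)) ->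
  n_times_differentiable n I u' -> n_times_differentiable n.+1 I u.
Proof.
move=> oI hu hu'.
have du x : I x -> differentiable u x.
  by move=> Ix; apply/derivable1_diffP; have [] := hu x Ix.
split=> // v; apply: ntd_eq (ntdM oI (ntd_cst n I v) hu') => // x /[1!inE] Ix.
by rewrite derive_scale; [have [_ ->] := hu x Ix|exact: du].
Qed.

End SmoothComp.

Section SmoothOn.
Context {R : realType} {V : normedModType R}.
Implicit Types (W : set V) (F G : V -> R).

Lemma smooth_on_eq W F G : open W -> {in W, F =1 G} ->
  smooth_on W F -> smooth_on W G.
Proof. by move=> oW FG sF n; exact: ntd_eq FG (sF n). Qed.

Lemma smooth_on_sub W1 W2 F : W1 `<=` W2 -> smooth_on W2 F -> smooth_on W1 F.
Proof. by move=> W12 sF n; exact: ntd_sub W12 (sF n). Qed.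

Lemma smooth_on_cst W (c : R) : smooth_on W (fun=> c).
Proof. by move=> n; exact: ntd_cst. Qed.

Lemma smooth_onD W F G : open W -> smooth_on W F -> smooth_on W G ->
  smooth_on W (fun p => F p + G p).
Proof. by move=> oW sF sG n; exact: ntdD (sF n) (sG n). Qed.

Lemma smooth_onM W F G : open W -> smooth_on W F -> smooth_on W G ->
  smooth_on W (fun p => F p * G p).
Proof. by move=> oW sF sG n; exact: ntdM (sF n) (sG n). Qed.

Lemma smooth_onN W F : open W -> smooth_on W F -> smooth_on W (fun p => - F p).
Proof.
move=> oW sF; apply: smooth_on_eq (smooth_onM oW (smooth_on_cst W (-1)) sF) => //.
by move=> p _; rewrite mulN1r.
Qed.

Lemma smooth_onB W F G : open W -> smooth_on W F -> smooth_on W G ->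
  smooth_on W (fun p => F p - G p).
Proof. by move=> oW sF sG; exact: smooth_onD (smooth_onN oW sG). Qed.

Lemma smooth_onX W F n : open W -> smooth_on W F ->
  smooth_on W (fun p => F p ^+ n).
Proof.
move=> oW sF; elim: n => [|n IH]; first exact: smooth_on_cst.
by apply: smooth_on_eq (smooth_onM oW sF IH) => // p _; rewrite exprS.
Qed.

Lemma smooth_on_comp W (I : set R) F (u : R -> R) :
  open W -> W `<=` F @^-1` I -> smooth_on W F -> smooth_on I u ->
  smooth_on W (fun p => u (F p)).
Proof. by move=> oW WI sF su n; exact: ntd_comp WI (sF n) (su n). Qed.

Lemma smooth_on_differentiable W F p : smooth_on W F -> W p ->
  differentiable F p.
Proof. by move=> /(_ 1%N)[dF _]; exact: dF. Qed.

End SmoothOn.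

(** * Smoothness of the elementary functions *)

Section SmoothReal.
Context {R : realType}.
Implicit Types (I : set R) (u : R -> R).

Lemma smooth_on_derive1 I u u' : open I ->
  (forall x, I x -> is_derive x 1 u (u' x)) -> smooth_on I u' -> smooth_on I u.
Proof. by move=> oI uu' su' [//|n]; exact: ntd1S uu' (su' n). Qed.

Lemma smooth_on_is_derive I u x : smooth_on I u -> I x ->
  is_derive x 1 u (derive1 u x).
Proof.
move=> su Ix; apply: DeriveDef; last by rewrite derive1E.
by apply/derivable1_diffP; exact: smooth_on_differentiable su Ix.
Qed.

Lemma derive1_smooth_on I u : smooth_on I u -> smooth_on I (derive1 u).
Proof.
move=> su n; have [_ /(_ 1)] := su n.+1.
by rewrite (_ : derive1 u = fun x => 'D_1 u x)//; apply/funext => x; rewrite derive1E.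
Qed.

Lemma smooth_on_id I : smooth_on I id.
Proof.
apply: (@smooth_on_sub _ _ _ [set: R]) => //.
apply: (@smooth_on_derive1 _ _ (fun=> 1)); first exact: openT.
exact: smooth_on_cst.
Qed.

Lemma smooth_on_expR : smooth_on [set: R] expR.
Proof.
by elim=> // n IH; apply: ntd1S IH; exact: openT.
Qed.

Lemma open_neq (a : R) : open [set x : R | x != a].
Proof.
rewrite (_ : [set x | _] = ~` [set a]); last first.
  by apply/seteqP; split=> x /= /eqP.
by rewrite openC; exact: closed_eq.
Qed.

Lemma smooth_on_inv : smooth_on [set x : R | x != 0] GRing.inv.
Proof.
(* The derivative is a polynomial in the inverse itself, so order [n] yields order [n.+1]. *)
elim=> // n IH; apply: (@ntd1S _ _ _ _ (fun x => -1 * (x^-1 * x^-1))).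
- exact: open_neq.
- move=> x /= x0; apply: (is_derive_eq (is_deriveV x0 (is_derive_id x 1))).
  by rewrite mulN1r expr2 invfM -[LHS]/(- _ * 1) mulr1.
- apply: ntdM; [exact: open_neq|exact: ntd_cst|].
  by apply: ntdM => //; exact: open_neq.
Qed.

Lemma smooth_on_ln : smooth_on [set x : R | 0 < x] (@ln R).
Proof.
apply: (@smooth_on_derive1 _ _ GRing.inv); first exact: open_gt.
by apply: smooth_on_sub smooth_on_inv => x /= /lt0r_neq0.
Qed.

(** A joint induction, since each function is up to sign the derivative of the other. *)
Lemma smooth_on_sin_cos n : n_times_differentiable n [set: R] sin /\
  n_times_differentiable n [set: R] cos.
Proof.
elim: n => // n [IHs IHc]; split.
  by apply: ntd1S IHc; exact: openT.
apply: (@ntd1S _ _ _ _ (fun x => -1 * sin x)); first exact: openT.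
  by move=> x _; rewrite mulN1r; exact: is_derive_cos.
by apply: ntdM => //; [exact: openT|exact: ntd_cst].
Qed.

End SmoothReal.

Section SmoothOnReal.
Context {R : realType} {V : normedModType R}.
Implicit Types (W : set V) (F G : V -> R).

Lemma smooth_on_compV W F : open W -> (forall p, W p -> F p != 0) ->
  smooth_on W F -> smooth_on W (fun p => (F p)^-1).
Proof. by move=> oW F0 sF; exact: smooth_on_comp F0 sF smooth_on_inv. Qed.

Lemma smooth_on_div W F G : open W -> (forall p, W p -> G p != 0) ->
  smooth_on W F -> smooth_on W G -> smooth_on W (fun p => F p / G p).
Proof.
by move=> oW G0 sF sG; apply: smooth_onM => //; exact: smooth_on_compV.
Qed.

Lemma smooth_on_comp_expR W F : open W ->
  smooth_on W F -> smooth_on W (fun p => expR (F p)).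
Proof. by move=> oW sF; exact: smooth_on_comp sF smooth_on_expR. Qed.

Lemma smooth_on_comp_sin W F : open W ->
  smooth_on W F -> smooth_on W (fun p => sin (F p)).
Proof.
move=> oW sF; apply: (@smooth_on_comp _ _ _ setT _ _ oW _ sF) => // n.
by have [] := @smooth_on_sin_cos R n.
Qed.

Lemma smooth_on_comp_cos W F : open W ->
  smooth_on W F -> smooth_on W (fun p => cos (F p)).
Proof.
move=> oW sF; apply: (@smooth_on_comp _ _ _ setT _ _ oW _ sF) => // n.
by have [] := @smooth_on_sin_cos R n.
Qed.

Lemma smooth_on_comp_ln W F : open W -> (forall p, W p -> 0 < F p) ->
  smooth_on W F -> smooth_on W (fun p => ln (F p)).
Proof. by move=> oW F0 sF; exact: smooth_on_comp F0 sF smooth_on_ln. Qed.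

Lemma smooth_on_comp_sqrt W F : open W -> (forall p, W p -> 0 < F p) ->
  smooth_on W F -> smooth_on W (fun p => Num.sqrt (F p)).
Proof.
move=> oW F0 sF.
(* Where [F] is positive, its square root is [expR (2^-1 * ln F)]. *)
have := smooth_on_comp_expR oW (smooth_onM oW (smooth_on_cst W 2^-1)
  (smooth_on_comp_ln oW F0 sF)).
apply: smooth_on_eq => // p /[1!inE] Wp.
rewrite -[LHS]gtr0_norm ?expR_gt0// -sqrtr_sqr.
rewrite expr2 -expRD (_ : _ + _ = ln (F p)); last by field.
by rewrite lnK// posrE F0.
Qed.

End SmoothOnReal.

Lemma smooth_on_coord (R : realType) n (W : set 'rV[R]_n) (j : 'I_n) :
  smooth_on W (fun p => p 0 j).
Proof.
have lin : linear (fun p : 'rV[R]_n => p 0 j : R) by move=> c p q; rewrite !mxE.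
pose L : {linear 'rV[R]_n -> R} :=
  HB.pack (fun p : 'rV[R]_n => p 0 j : R) (GRing.isLinear.Build _ _ _ _ _ lin).
by move=> k; apply: (@ntd_linear _ _ k W L); exact: coord_continuous.
Qed.

(** * Hadamard's lemma *)

Section Hadamard.
Context {R : realType}.
Implicit Types (W : set R) (f h : R -> R).

(* The primitive [P] encodes
   [h x = \int_0^1 s ^ k * f (a + s * (x - a)) ds], whose derivative is the same
   integral for [k.+1] and [f']; no integral is needed to show this. *)
Definition weighted_mean W (a : R) k f h := exists P : R -> R,
  [/\ forall x, W x -> is_derive x 1 P ((x - a) ^+ k * f x), P a = 0,
      forall x, (x - a) ^+ k.+1 * h x = P x & h a = f a / k.+1%:R].

Lemma is_derive_pow_sub (a x : R) n :
  is_derive x 1 (fun y => (y - a) ^+ n.+1) (n.+1%:R * (x - a) ^+ n).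
Proof.
have H : is_derive x 1 (fun y : R => y - a) 1.
  by apply: is_derive_eq; rewrite subr0.
have := is_deriveX n.+1 H; rewrite exprfctE => H1; apply: (is_derive_eq H1).
by rewrite /= -[LHS]/(_ * 1) mulr1.
Qed.

Lemma is_derive1_continuous (f : R -> R) (x df : R) :
  is_derive x 1 f df -> {for x, continuous f}.
Proof.
by move=> [dfx _]; apply/differentiable_continuous/derivable1_diffP.
Qed.

(** Differentiation under the integral sign: the weight gains a factor [s] and [f] becomes [f'].
    Away from [a] this is the quotient rule for [P / (x - a) ^+ k.+1]; at [a] it is l'Hopital's
    rule. *)
Lemma weighted_mean_derive W a k f f' h : open W -> W a ->
  (forall x, W x -> is_derive x 1 f (f' x)) -> weighted_mean W a k f h ->
  exists2 h' : R -> R, forall x, W x -> is_derive x 1 h (h' x) &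
    weighted_mean W a k.+1 f' h'.
Proof.
move=> oW Wa ff' [P [dP Pa hP ha]].
(* Integration by parts: [Q] is the primitive of [(x - a) ^+ k.+1 * f' x] vanishing at [a]. *)
pose Q x := (x - a) ^+ k.+1 * f x - k.+1%:R * P x.
pose h' x := if x == a then f' a / k.+2%:R else Q x / (x - a) ^+ k.+2.
have dQ x : W x -> is_derive x 1 Q ((x - a) ^+ k.+1 * f' x).
  move=> Wx; have dp := is_derive_pow_sub a x k.
  have := is_deriveB (is_deriveM dp (ff' x Wx)) (is_deriveZ k.+1%:R (dP x Wx)).
  move=> H; apply: (is_derive_eq H).
  by rewrite -![_ *: _]/(_ * _); ring.
exists h'; last first.
  exists Q; split => //.
  - by rewrite /Q Pa subrr exprS !mul0r mulr0 subrr.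
  - move=> x; rewrite /h'; case: eqVneq => [->|xa].
      by rewrite subrr exprS !mul0r /Q Pa subrr exprS !mul0r mulr0 subrr.
    by rewrite mulrC divfK// expf_neq0// subr_eq0.
  - by rewrite /h' eqxx.
move=> x Wx; rewrite /h'; case: eqVneq => [->|xa]; last first.
  have xa0 : x - a != 0 by rewrite subr_eq0.
  have dV := @is_deriveV _ (fun y => (y - a) ^+ k.+1) x _ _
    (expf_neq0 k.+1 xa0) (is_derive_pow_sub a x k).
  have dPV := is_deriveM (dP x Wx) dV.
  have PVh : \near x, (P * (fun y => ((y - a) ^+ k.+1)^-1)) x = h x.
    have : nbhs x [set y | y != a].
      by apply: open_nbhs_nbhs; split=> //; exact: open_neq.
    apply: filterS => y /= ya; rewrite mulrfctE -hP mulrC mulKf//.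
    by rewrite expf_neq0// subr_eq0.
  apply: (is_derive_eq (near_eq_is_derive PVh dPV)).
  rewrite /Q -![_ *: _]/(_ * _) -hP !exprS; field.
  by rewrite xa0 expf_neq0.
clear x Wx.
(* Since [f'] need not be continuous, the slope function [g] of [f] at [a] takes its place:
   [f x - f a = g x * (x - a)], with [g] continuous at [a]. *)
have /is_derive1_caratheodory[g [fg cg ga]] := ff' a Wa.
pose l := f' a / k.+2%:R.
have k10 : k.+1%:R != 0 :> R by rewrite pnatr_eq0.
have k20 : k.+2%:R != 0 :> R by rewrite pnatr_eq0.
(* This is [(x - a) ^+ k.+1 * (h x - h a)], so [num x / (x - a) ^+ k.+2] is the difference quotient
   of [h] at [a]. *)
pose num x := P x - f a / k.+1%:R * (x - a) ^+ k.+1.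
(* The values at [a] are chosen to make [dnum / dden] equal to [g / k.+2%:R] everywhere, hence
   continuous at [a]. *)
pose dnum x := if x == a then l else (x - a) ^+ k.+1 * g x.
pose dden x := if x == a then 1 else k.+2%:R * (x - a) ^+ k.+1.
have /nbhs_ballP[e /= e0 We] : nbhs a W by exact: open_nbhs_nbhs.
have aI : a \in `](a - e), (a + e)[ by rewrite in_itv/= ltrBlDr ltrDl e0.
have IW x : x \in `](a - e), (a + e)[ `\ a -> W x /\ x != a.
  rewrite inE /= in_itv/= => -[xe /eqP xa]; split=> //; apply: We.
  by rewrite /ball/= ltr_distlC.
have dnumE x : W x -> is_derive x 1 num ((x - a) ^+ k * (f x - f a)).
  move=> Wx; have dp := is_derive_pow_sub a x k.
  have H := is_deriveB (dP x Wx) (is_deriveZ (f a / k.+1%:R) dp).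
  apply: (is_derive_eq H); rewrite -![_ *: _]/(_ * _).
  by move: k10; move: (k.+1%:R : R) (_ ^+ k) => c d c0; field.
have quot : num x / (x - a) ^+ k.+2 @[x --> a^'] --> l.
  apply: (@lhopital _ num dnum _ dden _ _ _ _ aI).
  - move=> x /IW[Wx xa]; rewrite /dnum (negbTE xa).
    by apply: (is_derive_eq (dnumE x Wx)); rewrite fg exprS; ring.
  - move=> x /IW[Wx xa]; rewrite /dden (negbTE xa).
    exact: is_derive_pow_sub.
  - have num0 : num a = 0 by rewrite /num Pa subrr exprS mul0r mulr0 subrr.
    by rewrite -{1}num0; exact: is_derive1_continuous (dnumE a Wa).
  - have pow0 : (a - a) ^+ k.+2 = 0 by rewrite subrr exprS mul0r.
    by rewrite -{1}pow0; exact: is_derive1_continuous (is_derive_pow_sub a a k.+1).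
  - move=> x /IW[Wx xa]; rewrite /dden (negbTE xa).
    by rewrite mulf_neq0 ?pnatr_eq0// expf_neq0// subr_eq0.
  - rewrite (_ : (fun x => _) = fun x => g x / k.+2%:R); last first.
      apply/funext => x; rewrite /dnum /dden; case: eqVneq => [->|xa].
        by rewrite /l ga divr1.
      have : (x - a) ^+ k.+1 != 0 by rewrite expf_neq0// subr_eq0.
      move: k20; move: (_ ^+ _) (_%:R) => c d d0 c0; field.
      by rewrite c0 d0.
    by rewrite /l -ga; apply: cvgMl.
apply/is_derive1_caratheodory.
exists (fun z => if z == a then l else (h z - h a) / (z - a)); split.
- move=> z; case: eqVneq => [->|za]; first by rewrite !subrr mulr0.
  by rewrite divfK// subr_eq0.
- apply/continuous_withinNx; rewrite eqxx; apply: cvg_trans quot.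
  apply: near_eq_cvg; rewrite near_withinE; near=> z => za.
  rewrite (negbTE za) /num -hP ha (exprSr _ k.+1).
  have za0 : z - a != 0 by rewrite subr_eq0.
  have : (z - a) ^+ k.+1 != 0 by rewrite expf_neq0.
  move: (_ ^+ _) (f a / _) => c d c0; field.
  by rewrite za0 c0.
- by rewrite eqxx.
Unshelve. all: by end_near. Qed.

(** The induction must range over all [k] and [f], because differentiating a mean raises the weight
    and replaces [f] by its derivative. *)
Lemma weighted_mean_smooth n W a k f h : open W -> W a -> smooth_on W f ->
  weighted_mean W a k f h -> n_times_differentiable n W h.
Proof.
move=> oW Wa; elim: n k f h => // n IH k f h sf fh.
have df x : W x -> is_derive x 1 f (derive1 f x).
  exact: smooth_on_is_derive sf.
have [h' dh wh'] := weighted_mean_derive oW Wa df fh.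
by apply: ntd1S dh _ => //; apply: IH wh'; exact: derive1_smooth_on.
Qed.

(** The quotient is the mean of weight 0 of the derivative of [f], with [f] itself as the
    primitive. *)
Lemma smooth_on_factor W a f : open W -> W a -> smooth_on W f -> f a = 0 ->
  exists F, [/\ smooth_on W F, forall x, f x = (x - a) * F x &
    F a = derive1 f a].
Proof.
move=> oW Wa sf fa.
(* With this definition the factorisation holds on the whole line, whereas smoothness is claimed on
   [W] only. *)
pose F x := if x == a then derive1 f a else f x / (x - a).
have fF x : f x = (x - a) * F x.
  rewrite /F; case: eqVneq => [->|xa]; first by rewrite subrr mul0r.
  by rewrite mulrC divfK// subr_eq0.
exists F; split => //; last by rewrite /F eqxx.
move=> n; apply: (@weighted_mean_smooth n W a 0 (derive1 f)) => //.
  exact: derive1_smooth_on.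
exists f; split=> // [x Wx|].
- by rewrite expr0 mul1r; exact: smooth_on_is_derive sf Wx.
- by rewrite /F eqxx divr1.
Qed.

End Hadamard.

(** * Primitives and inverse functions *)

Section PrimitiveInverse.
Context {R : realType}.

(** The fundamental theorem of calculus, based at [a - e / 2] and normalised at [a]. Halving [e]
    leaves a compact segment on which [p] is continuous, hence integrable. *)
Lemma primitive_near (a e : R) (p : R -> R) : 0 < e ->
  (forall x, a - e < x < a + e -> {for x, continuous p}) ->
  exists2 P : R -> R, P a = 0 &
    forall x, a - e / 2 < x < a + e / 2 -> is_derive x 1 P (p x).
Proof.
move=> e0 cp.
pose l := a - e / 2; pose u := a + e / 2.
pose F x := (\int[lebesgue_measure]_(t in `[l, x]) p t).
have ip : lebesgue_measure.-integrable `[l, u] (EFin \o p).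
  apply: continuous_compact_integrable; first exact: segment_compact.
  apply: continuous_in_subspaceT => x /[1!inE] /=; rewrite in_itv/= => /andP[lx xu].
  by apply: cp; apply/andP; rewrite /l /u in lx xu; split; lra.
exists (fun x => F x - F a); first by rewrite subrr.
move=> x /andP[lx xu].
have cx : {for x, continuous p}.
  by apply: cp; apply/andP; split; lra.
have [dF FE] := continuous_FTC1_closed xu ip lx cx.
have dF' : is_derive x 1 F (p x)
  by apply: DeriveDef; [exact: dF|rewrite -derive1E; exact: FE].
have := is_deriveB dF' (is_derive_cst (F a) x 1).
by rewrite subr0.
Qed.

(** [S] is strictly increasing, so the intermediate value theorem gives a unique preimage.
    Smoothness bootstraps from the derivative of [rho] being the inverse of [derive1 S] at [rho]. *)
Lemma smooth_inverse (W : set R) (l u : R) (S : R -> R) :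
  l < u -> open W -> `[l, u] `<=` W -> smooth_on W S ->
  (forall x, l <= x <= u -> 0 < derive1 S x) ->
  exists rho : R -> R,
  [/\ smooth_on `]S l, S u[ rho,
      forall x, l < x < u -> rho (S x) = x &
      forall y, S l < y < S u -> l < rho y < u /\ S (rho y) = y].
Proof.
move=> lu oW IW sS S'0.
have dS x : l <= x <= u -> is_derive x 1 S (derive1 S x).
  by move=> xI; apply: smooth_on_is_derive sS _; apply: IW; rewrite /= in_itv.
have cS : {within `[l, u], continuous S}.
  apply: continuous_in_subspaceT => x /[1!inE]; rewrite /= in_itv/= => xI.
  exact: is_derive1_continuous (dS x xI).
have incS x y : l <= x <= u -> l <= y <= u -> x < y -> S x < S y.
  move=> xI yI; apply: (@gtr0_derive1_lt_cc _ S l u) => //; rewrite ?in_itv//=.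
  - by move=> z; rewrite in_itv/= => /andP[lz zu]; have [] := dS z; rewrite ?ltW.
  - by move=> z; rewrite in_itv/= => /andP[lz zu]; apply: S'0; rewrite !ltW.
have Sinj x y : l <= x <= u -> l <= y <= u -> S x = S y -> x = y.
  move=> xI yI Sxy; case: (ltgtP x y) => // xy.
    by have := incS _ _ xI yI xy; rewrite Sxy ltxx.
  by have := incS _ _ yI xI xy; rewrite Sxy ltxx.
have lI : l <= l <= u by rewrite lexx ltW.
have uI : l <= u <= u by rewrite lexx ltW.
have ivt y : S l < y < S u -> exists x, (l < x < u) /\ S x = y.
  move=> /andP[ly yu].
  have lSu := ltW (lt_trans ly yu).
  have [|x] := @IVT _ S l u y (ltW lu) cS.
    by rewrite (min_idPl lSu) (max_idPr lSu) !ltW.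
  rewrite in_itv/= => /andP[lx xu] Sx; exists x; split=> //.
  rewrite !lt_neqAle lx xu !andbT; apply/andP; split.
    by apply/eqP => lxE; move: ly; rewrite -Sx -lxE ltxx.
  by apply/eqP => xuE; move: yu; rewrite -Sx xuE ltxx.
pose rho y := get [set x | (l < x < u) /\ S x = y].
have rhoP y : S l < y < S u -> (l < rho y < u) /\ S (rho y) = y.
  by move=> /ivt /(@getPex _ [set x | (l < x < u) /\ S x = y]).
have oc (x : R) : l < x < u -> l <= x <= u by move=> /andP[? ?]; rewrite !ltW.
have rhoS x : l < x < u -> rho (S x) = x.
  move=> xI; have [] : (l < rho (S x) < u) /\ S (rho (S x)) = S x.
    have /andP[lx xu] := xI.
    by apply: rhoP; apply/andP; split; apply: incS => //; exact: oc.
  by move=> rI; apply: Sinj; exact: oc.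
exists rho; split=> //.
have drho y : S l < y < S u -> is_derive y 1 rho (derive1 S (rho y))^-1.
  move=> yI; have [xI Sx] := rhoP y yI.
  rewrite -{1}Sx.
  have nx : nbhs (rho y) [set` `]l, u[].
    by apply: open_nbhs_nbhs; split; [exact: interval_open|rewrite /= in_itv].
  apply: is_derive_inverse; last 2 first.
  - exact/dS/oc.
  - by rewrite gt_eqF// S'0// oc.
  - by apply: filterS nx => x; rewrite /= in_itv/= => /rhoS.
  - apply: filterS nx => x; rewrite /= in_itv/= => /oc /dS.
    exact: is_derive1_continuous.
have oJ : open [set` `]S l, S u[] by exact: interval_open.
(* If [rho] has order [n], so does this derivative, and [rho] has order [n.+1]. *)
elim=> // n IH; apply: (@ntd1S _ _ _ _ (fun y => (derive1 S (rho y))^-1)) => //.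
apply: (ntd_comp oJ _ _ (@smooth_on_inv R n)).
  move=> y; rewrite /= in_itv/= => /rhoP[xI _].
  by rewrite gt_eqF// S'0// oc.
apply: (@ntd_comp _ _ _ _ W) => //; last exact: derive1_smooth_on.
by move=> y; rewrite /= in_itv/= => /rhoP[xI _]; apply: IW; rewrite /= in_itv/= oc.
Qed.

End PrimitiveInverse.

(** * The function [S] of the radius that equals the product of the null coordinates *)

Section RegularCoordinate.
Context {R : realType}.

(** [S] solves [S' / S = q / (x - a)]: as [q a = 1], one has [q = 1 + (x - a) p] with [p] smooth,
    and [h] is the exponential of the primitive of [p] vanishing at [a]. Near [a], [q] is positive,
    hence so is [S'], and [S] has a smooth inverse. *)
Lemma regular_coordinate (a : R) (W : set R) (q : R -> R) :
  0 < a -> open W -> W a -> smooth_on W q -> q a = 1 ->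
  exists (e d : R) (h rho : R -> R),
    let S x := (x / a - 1) * h x in
    [/\ [/\ 0 < e, 0 < d & `]a - e, a + e[ `<=` W],
        [/\ smooth_on `]a - e, a + e[ h, h a = 1 & forall x, 0 < h x],
        forall x, a - e < x < a + e -> is_derive x 1 S (h x / a * q x) &
        [/\ smooth_on `]- d, d[ rho,
            forall x, a - e < x < a + e -> rho (S x) = x &
            forall y, - d < y < d -> a - e < rho y < a + e /\ S (rho y) = y]].
Proof.
move=> a0 oW Wa sq qa.
have sq1 : smooth_on W (fun x => q x - 1).
  by apply: smooth_onB => //; exact: smooth_on_cst.
have [|p [sp qp _]] := smooth_on_factor oW Wa sq1; first by rewrite qa subrr.
have cq : {for a, continuous q}.
  exact: is_derive1_continuous (smooth_on_is_derive sq Wa).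
have nW : nbhs a W by exact: open_nbhs_nbhs.
have q0 : \near a, 0 < q a by apply: cvgr_gt cq _ _; rewrite qa.
have /nbhs_ballP[e0 /= e00 eW] : nbhs a [set x | W x /\ 0 < q x].
  exact: filterI nW q0.
have {}eW x : a - e0 < x < a + e0 -> W x /\ 0 < q x.
  by move=> xI; apply: eW; rewrite /ball/= ltr_distlC.
have [|P Pa dP] := @primitive_near _ a e0 p e00.
  move=> x /eW[Wx _].
  exact: is_derive1_continuous (smooth_on_is_derive sp Wx).
pose I := [set` `]a - e0 / 2, a + e0 / 2[].
have oI : open I by exact: interval_open.
have II x : I x -> a - e0 < x < a + e0.
  rewrite /I /= in_itv/= => /andP[lx xu]; apply/andP; split; lra.
have IW : I `<=` W by move=> x /II /eW[].
pose h x := expR (P x); pose S x := (x / a - 1) * h x.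
have sP : smooth_on I P.
  have dPI x : I x -> is_derive x 1 P (p x).
    by rewrite /I /= in_itv/=; exact: dP.
  exact: smooth_on_derive1 oI dPI (smooth_on_sub IW sp).
have sh : smooth_on I h by exact: smooth_on_comp_expR.
have sS : smooth_on I S.
  apply: smooth_onM => //; apply: smooth_onB => //; last exact: smooth_on_cst.
  by apply: smooth_onM => //; [exact: smooth_on_id|exact: smooth_on_cst].
have h0 x : 0 < h x by exact: expR_gt0.
have dS x : I x -> is_derive x 1 S (h x / a * q x).
  move=> Ix.
  have dPx : is_derive x 1 P (p x) by move: Ix; rewrite /I /= in_itv/=; exact: dP.
  have dh : is_derive x 1 h (h x * p x) := is_derive1_comp (is_derive_expR (P x)) dPx.
  have d1 : is_derive x 1 (fun x : R => x / a - 1) a^-1.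
    by apply: is_derive_eq; rewrite subr0 scaler0 add0r -[LHS]/(_ * _) mulr1.
  apply: (is_derive_eq (is_deriveM d1 dh)); rewrite -![_ *: _]/(_ * _).
  have -> : q x = 1 + (x - a) * p x by rewrite -qp subrKC.
  by field; rewrite gt_eqF.
(* A quarter of [e0] puts the closed interval of radius [e] inside the open interval [I] of radius
   [e0 / 2]. *)
pose e := e0 / 4.
have e0' : 0 < e by rewrite /e; lra.
have eI x : a - e <= x <= a + e -> I x.
  by rewrite /I /= in_itv/= /e => /andP[? ?]; apply/andP; split; lra.
have [|||rho [srho rhoS Srho]] :=
  @smooth_inverse _ I (a - e) (a + e) S _ oI _ sS.
- by rewrite ltrD2l; lra.
- by move=> x; rewrite /= in_itv/=; exact: eI.
- move=> x /eI Ix; have [_] := dS x Ix; rewrite -derive1E => ->.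
  by rewrite !mulr_gt0// ?invr_gt0//; have [] := eW x (II x Ix).
have Sl : S (a - e) < 0.
  have -> : S (a - e) = - (e / a * h (a - e)) by rewrite /S; field; rewrite gt_eqF.
  by rewrite oppr_lt0 mulr_gt0 ?divr_gt0.
have Su : 0 < S (a + e).
  have -> : S (a + e) = e / a * h (a + e) by rewrite /S; field; rewrite gt_eqF.
  by rewrite mulr_gt0 ?divr_gt0.
(* As [S (a - e) < 0 < S (a + e)], this is the largest symmetric interval contained in the range. *)
pose d := Num.min (- S (a - e)) (S (a + e)).
exists e, d, h, rho; split.
- split=> //; first by rewrite /d lt_min oppr_gt0 Sl.
  by move=> x; rewrite /= in_itv/= => /andP[? ?]; apply/IW/eI; rewrite !ltW.
- split=> //; last by rewrite /h Pa expR0.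
  apply: smooth_on_sub sh => x; rewrite /= in_itv/= => /andP[? ?].
  by apply: eI; rewrite !ltW.
- by move=> x /andP[? ?]; apply/dS/eI; rewrite !ltW.
- have dI y : - d < y < d -> S (a - e) < y < S (a + e).
    by rewrite /d ltrNl !lt_min ltrNr opprK => /andP[/andP[-> _] /andP[_ ->]].
  split=> //.
  + by apply: smooth_on_sub srho => y; rewrite /= !in_itv/=; exact: dI.
  + by move=> y /dI /Srho.
Qed.

End RegularCoordinate.

(** * Row vectors and neighbourhoods of the horizon *)

Section RowVectors.
Context {R : realType} {n : nat}.
Implicit Types (j : 'I_n) (x : 'rV[R]_n).

Lemma continuous_coord j : continuous (fun x : 'rV[R]_n => x 0 j).
Proof.
move=> x; apply: differentiable_continuous; exact: differentiable_coord.
Qed.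

Lemma open_coord j (A : set R) : open A -> open [set x : 'rV[R]_n | A (x 0 j)].
Proof. by move=> oA; apply: open_comp oA => x _; exact: continuous_coord. Qed.

Lemma is_diff_coord j x : is_diff x (fun y => y 0 j) (fun v => v 0 j).
Proof.
have lin : linear (fun p : 'rV[R]_n => p 0 j : R) by move=> c p q; rewrite !mxE.
pose L : {linear 'rV[R]_n -> R} :=
  HB.pack (fun p : 'rV[R]_n => p 0 j : R) (GRing.isLinear.Build _ _ _ _ _ lin).
have cL : continuous L by exact: continuous_coord.
by apply: DiffDef; [exact: differentiable_coord|exact: (@diff_lin _ _ _ L x cL)].
Qed.

(** Both arguments are expanded in the standard basis; linearity in the second follows from
    symmetry. *)
Lemma bilinear_mxE (b : 'rV[R]_n -> 'rV[R]_n -> R) v w :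
  (forall c u v w, b (c *: u + v) w = c * b u w + b v w) ->
  (forall u v, b u v = b v u) ->
  (v *m (\matrix_(i, j) b (delta_mx 0 i) (delta_mx 0 j)) *m w^T) 0 0 = b v w.
Proof.
move=> bl bs.
have b0 w' : b 0 w' = 0.
  by have := bl (-1) 0 0 w'; rewrite scaler0 addr0 mulN1r addNr.
have bE u w' : b u w' = \sum_i u 0 i * b (delta_mx 0 i) w'.
  rewrite {1}[u]row_sum_delta.
  have bD x y : b (x + y) w' = b x w' + b y w'.
    by rewrite -[x]scale1r bl mul1r scale1r.
  rewrite (big_morph (b^~ w') bD (b0 w')); apply: eq_bigr => i _.
  by rewrite -[_ *: _]addr0 bl b0 addr0.
rewrite bs bE mxE; apply: eq_bigr => j _.
rewrite bs bE !mxE mulrC; congr (_ * _).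
by apply: eq_bigr => i _; rewrite !mxE.
Qed.

End RowVectors.

Lemma is_diff_comp1 (R : realType) (V : normedModType R) (F dF : V -> R) (x : V)
    (u : R -> R) (u' : R) :
  is_derive (F x) 1 u u' -> is_diff x F dF ->
  is_diff x (fun y => u (F y)) (fun v => u' * dF v).
Proof.
move=> [du u'E] [dFx FE].
have du1 : differentiable u (F x) by apply/derivable1_diffP.
apply: DiffDef; first exact: differentiable_comp.
apply/funext => v; rewrite diff_comp// FE/= -deriveE// derive_scale//.
by rewrite u'E mulrC.
Qed.

(** Linear algebra behind nondegeneracy: a vector orthogonal to all test vectors
    [(wu, wv, wt, wp, wq)] is trivial. Here [mP] and [mQ] are its angular components corrected by
    [beta] times [tau], and the angular block has determinant [B * C * s ^+ 2 * c ^+ 2]. *)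
Lemma kernel_null_form (R : realFieldType)
    (E C B s c beta pU pV vU vV vt mP mQ : R) :
  E != 0 -> C != 0 -> B != 0 -> s != 0 -> c != 0 -> c ^+ 2 + s ^+ 2 = 1 ->
  (forall wu wv wt wp wq,
    E / 2 * (vU * wv + vV * wu) + C * (vt * wt)
    + B * (s ^+ 2 * (mP * (wp - beta * (pV * wu - pU * wv)))
           + c ^+ 2 * (mQ * (wq - beta * (pV * wu - pU * wv))))
    + (C - B) * (s ^+ 2 * c ^+ 2 * ((mP - mQ) * (wp - wq))) = 0) ->
  [/\ vU = 0, vV = 0, vt = 0, mP = 0 & mQ = 0].
Proof.
move=> En Cn Bn sn cn sc H.
have {}En : E / 2 != 0 by rewrite mulf_neq0// invr_neq0// pnatr_eq0.
have mPQ : mP = mQ.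
  have KPQ : C * s ^+ 2 * c ^+ 2 * (mP - mQ) = 0.
    have KP : B * (s ^+ 2 * mP) + (C - B) * (s ^+ 2 * c ^+ 2 * (mP - mQ)) = 0.
      by rewrite -(H 0 0 0 1 0); ring.
    have KQ : B * (c ^+ 2 * mQ) - (C - B) * (s ^+ 2 * c ^+ 2 * (mP - mQ)) = 0.
      by rewrite -(H 0 0 0 0 1); ring.
    (* In this combination the terms in [B] cancel, by [c ^+ 2 + s ^+ 2 = 1]. *)
    have := congr2 (fun x y => c ^+ 2 * x - s ^+ 2 * y) KP KQ.
    rewrite !mulr0 subrr => <-; apply/eqP; rewrite -subr_eq0.
    rewrite [X in X == 0](_ : _ = (C - B) * s ^+ 2 * c ^+ 2 * (mP - mQ)
      * (1 - (c ^+ 2 + s ^+ 2))); last by ring.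
    by rewrite sc subrr mulr0.
  apply/eqP; rewrite -subr_eq0; apply: contraT => m0.
  by move/eqP: KPQ; rewrite !mulf_eq0/= (negbTE Cn) (negbTE sn)
    (negbTE cn) (negbTE m0).
have mQ0 : mQ = 0.
  have : B * s ^+ 2 * mQ = 0 by rewrite -(H 0 0 0 1 0) mPQ; ring.
  by move/eqP; rewrite !mulf_eq0/= (negbTE Bn) (negbTE sn) => /eqP.
have HU : E / 2 * vU = 0 by rewrite -(H 0 1 0 0 0) mPQ mQ0; ring.
have HV : E / 2 * vV = 0 by rewrite -(H 1 0 0 0 0) mPQ mQ0; ring.
have Ht : C * vt = 0 by rewrite -(H 0 0 1 0 0) mPQ mQ0; ring.
move/eqP: HU; rewrite mulf_eq0 (negbTE En) => /eqP->.
move/eqP: HV; rewrite mulf_eq0 (negbTE En) => /eqP->.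
by move/eqP: Ht; rewrite mulf_eq0 (negbTE Cn) => /eqP->; rewrite mPQ mQ0.
Qed.

(** * Neighbourhoods of the bifurcation sphere and approach to the horizons *)

Section HorizonNeighbourhoods.
Context {R : realType}.

Lemma open_exterior (a e : R) : open (exterior a e).
Proof.
rewrite (_ : exterior a e = [set x | `]a, a + e[%classic (x 0 iR)] `&`
  [set x | `]0, pi / 2[%classic (x 0 iTheta)]); last first.
  by apply/seteqP; split=> x; rewrite /exterior /= !in_itv/=.
by apply: openI; apply: open_coord; exact: interval_open.
Qed.

Lemma open_bif_nbhd (d : R) : open (bif_nbhd d).
Proof.
rewrite (_ : bif_nbhd d = [set x | `]- d, d[%classic (x 0 iU)] `&`
  [set x | `]- d, d[%classic (x 0 iV)]); last first.
  by apply/seteqP; split=> x; rewrite /bif_nbhd /= !in_itv/= !ltr_norml.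
by apply: openI; apply: open_coord; exact: interval_open.
Qed.

Lemma vec5P (x y : 'rV[R]_5) :
  x 0 iU = y 0 iU -> x 0 iV = y 0 iV -> x 0 iTheta = y 0 iTheta ->
  x 0 iphi = y 0 iphi -> x 0 ipsi = y 0 ipsi -> x = y.
Proof.
move=> h0 h1 h2 h3 h4.
by apply/rowP => -[[|[|[|[|[|//]]]]] lti]; rewrite (bool_irrelevance lti isT).
Qed.

Lemma cvg_pinfty_scale (c : R) (u : nat -> R) : 0 < c ->
  u @ \oo --> pinfty_nbhs R -> (fun n => c * u n) @ \oo --> pinfty_nbhs R.
Proof.
move=> c0 cu.
exact: (@cvg_comp _ _ _ u ( *%R c) _ _ _ cu (gt0_cvgMry (f := id) c0 cvg_id)).
Qed.

Lemma cvg_pinfty_scaleN (c : R) (u : nat -> R) : 0 < c ->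
  u @ \oo --> ninfty_nbhs R -> (fun n => c * - u n) @ \oo --> pinfty_nbhs R.
Proof. by move=> c0 /cvgNry cu; exact: cvg_pinfty_scale c0 cu. Qed.

(** The prescribed ratio [expR n%:R] drives the time, a multiple of the logarithm of [U / V], to
    infinity. Corner points and the ends of the [theta] range are included, so the sequence has to
    move off them too. *)
Lemma approach_face (delta : R) (i j : 'I_5) (p : 'rV[R]_5) :
  i != j -> i != iTheta -> j != iTheta ->
  0 <= p 0 i < delta -> p 0 j = 0 -> 0 <= p 0 iTheta <= pi / 2 ->
  exists2 pn : nat -> 'rV[R]_5, pn @ \oo --> p &
    forall n, [/\ 0 < pn n 0 i < delta, 0 < pn n 0 j < delta,
      0 < pn n 0 iTheta < pi / 2 & pn n 0 i / pn n 0 j = expR n%:R].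
Proof.
move=> ij iT jT /andP[pi0 pid] pj0 /andP[pt0 pt1].
(* The first bound gives [en n < 1], the second keeps coordinate [i] below [delta]. *)
pose eta : R := Num.min (1 / 2) ((delta - p 0 i) / 2).
have eta0 : 0 < eta by rewrite lt_min !divr_gt0// subr_gt0.
pose en n := eta * @harmonic R n.
have en0 n : 0 < en n by rewrite mulr_gt0// invr_gt0.
have en_eta n : en n <= eta by rewrite ger_pMr// invf_le1// ler1n.
have en1 n : en n < 1.
  by rewrite (le_lt_trans (en_eta n))// gt_min; apply/orP; left; lra.
have end_ n : p 0 i + en n < delta.
  have : en n <= (delta - p 0 i) / 2.
    by rewrite (le_trans (en_eta n))// ge_min lexx orbT.
  by move=> ?; lra.
have cen : en @ \oo --> (0 : R).
  by rewrite -[X in _ --> X](mulr0 eta); apply: cvgMr; exact: cvg_harmonic.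
have cexp : (fun n : nat => expR (- n%:R) : R) @ \oo --> (0 : R).
  exact: (@cvg_comp _ _ _ (fun n : nat => n%:R : R) (fun x => expR (- x)) _ _ _
    cvgr_idn (@cvgr_expR R)).
have cex : (fun n => (p 0 i + en n) * expR (- n%:R)) @ \oo --> (0 : R).
  rewrite -[X in _ --> X](mulr0 (p 0 i + 0)); apply: cvgM.
    by apply: cvgD cen; exact: cvg_cst.
  exact: cexp.
(* Coordinate [i] is raised by [en n], [theta] moves the fraction [en n] of the way to [pi / 4], and
   coordinate [j] becomes the new coordinate [i] times [expR (- n%:R)]. *)
exists (fun n => p + en n *: (delta_mx 0 i + (pi / 4 - p 0 iTheta) *: delta_mx 0 iTheta)
  + ((p 0 i + en n) * expR (- n%:R)) *: delta_mx 0 j).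
  rewrite -[X in _ --> X]addr0; apply: cvgD.
    rewrite -[X in _ --> X]addr0; apply: cvgD; first exact: cvg_cst.
    by rewrite -(scale0r (delta_mx 0 i + (pi / 4 - p 0 iTheta) *: delta_mx 0 iTheta));
      apply: cvgZr_tmp.
  by rewrite -(scale0r (delta_mx 0 j)); apply: cvgZr_tmp.
move=> n; rewrite !mxE !eqxx /= (negbTE ij) (negbTE iT) (eq_sym j i) (negbTE ij).
rewrite (negbTE jT) !(eq_sym iTheta) (negbTE iT) (negbTE jT) pj0.
rewrite !(mulr0, mulr1, addr0, add0r).
have pe0 : 0 < p 0 i + en n by rewrite ltr_wpDl.
have ex0 := expR_gt0 (- n%:R : R).
split.
- by rewrite pe0 end_.
- by rewrite mulr_gt0//= (le_lt_trans _ (end_ n))// ger_pMr//.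
- have h1 : 0 <= (1 - en n) * p 0 iTheta by rewrite mulr_ge0// subr_ge0 ltW.
  have h2 : 0 <= (1 - en n) * (pi / 2 - p 0 iTheta).
    by rewrite mulr_ge0// ?subr_ge0// ltW.
  have h3 : 0 < en n * pi by rewrite mulr_gt0 ?pi_gt0.
  by apply/andP; split; nra.
- by rewrite invfM mulrA divff ?gt_eqF// mul1r expRN invrK.
Qed.

End HorizonNeighbourhoods.

(** * First-order expansions *)

Section FirstOrder.
Context {R : realType}.

(** The quadratic bound at [a] itself forces [f a = 0]; divided by [r - a], it bounds the error of
    the difference quotient linearly. *)
Lemma first_order_bigO (f : R -> R) (a c : R) :
  f = (fun r => c * (r - a)) +O_ (nbhs a) (fun r => (r - a) ^+ 2) ->
  f a = 0 /\ derive1 f a = c.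
Proof.
move=> /eqaddOP [K [_ /(_ (`|K| + 1))]].
have KK : K < `|K| + 1 by rewrite (le_lt_trans (ler_norm K))// ltrDl.
move=> /(_ KK); set L := `|K| + 1 => near_f.
have L0 : 0 < L by rewrite ltr_wpDl.
have fa : f a = 0.
  have := nbhs_singleton near_f; rewrite !fctE /= subrr mulr0 subr0.
  by rewrite expr0n/= normr0 mulr0 normr_le0 => /eqP.
split=> //.
suff [_ <-] : is_derive a 1 f c by rewrite derive1E.
apply/is_derive1_caratheodory.
exists (fun z => if z == a then c else f z / (z - a)); split.
- move=> z; case: eqVneq => [->|za]; first by rewrite !subrr mulr0.
  by rewrite fa subr0 divfK// subr_eq0.
- apply/continuous_withinNx; rewrite eqxx; apply/cvgrPdist_le => eps eps0.
  have eL0 : 0 < eps / L by rewrite divr_gt0.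
  have near_a : nbhs a (ball a (eps / L)) := nbhsx_ballx a _ eL0.
  rewrite near_withinE.
  have near_f' : nbhs a [set r | `|f r - c * (r - a)| <= L * `|(r - a) ^+ 2|].
    exact: near_f.
  apply: filterS (filterI near_f' near_a) => z [/= fz]; rewrite /ball/= distrC => az za.
  rewrite (negbTE za); have za0 : 0 < `|z - a| by rewrite normr_gt0 subr_eq0.
  rewrite -(ler_pM2r za0) -normrM mulrBl divfK ?subr_eq0// distrC.
  apply: (le_trans fz); rewrite normrX expr2 mulrA ler_wpM2r//.
  by rewrite mulrC -ler_pdivlMr// ltW.
- by rewrite eqxx.
Qed.

(** By Hadamard's lemma the remainder is [r - a] times a function continuous at [a], hence locally
    bounded. *)
Lemma smooth_on_bigO (W : set R) (h : R -> R) (a : R) :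
  open W -> W a -> smooth_on W h ->
  h = (fun _ => h a) +O_ (nbhs a) (fun r => r - a).
Proof.
move=> oW Wa sh.
have sh1 : smooth_on W (fun r => h r - h a).
  by apply: smooth_onB => //; exact: smooth_on_cst.
have [|H [sH hH _]] := smooth_on_factor oW Wa sh1; first by rewrite subrr.
have cH : {for a, continuous H}.
  exact: is_derive1_continuous (smooth_on_is_derive sH Wa).
apply/eqaddOP; exists (`|H a| + 1); split; first by rewrite num_real.
move=> K HK; have : \forall r \near a, `|H r| < K.
  have HaK : `|H a| < K by rewrite (le_lt_trans _ HK)// lerDl.
  by apply: cvgr_lt (cvg_norm cH) _ HaK.
have Hbound r : `|H r| < K ->
    `|(h - (fun=> h a)) r| <= K * `|r - a|.
  move=> /ltW Hr; rewrite !fctE hH normrM mulrC.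
  by rewrite ler_wpM2r.
by move=> HK'; exact: (@filterS _ (nbhs a) _ _ _ Hbound).
Qed.

End FirstOrder.

(** * The extension across the horizons *)

Section KruskalExtension.
Context {R : realType} (a rm2 e d k : R) (f m varpi F M w h rho : R -> R).

Let q r := k / 2 * Num.sqrt (M r / (r - rm2)) / F r.
Let S r := (r / a - 1) * h r.

Hypotheses (a0 : 0 < a) (k0 : 0 < k) (e0 : 0 < e) (d0 : 0 < d).
Hypotheses (fE : forall r : R, f r = (r - a) * F r)
  (mE : forall r, m r = (r - a) * M r)
  (varpiE : forall r, varpi r = varpi a + (r - a) * w r).
Hypotheses (sF : smooth_on `]a - e, a + e[ F) (sM : smooth_on `]a - e, a + e[ M)
  (sw : smooth_on `]a - e, a + e[ w) (sh : smooth_on `]a - e, a + e[ h).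
Hypotheses (F0 : forall r : R, a - e < r < a + e -> 0 < F r)
  (M0 : forall r : R, a - e < r < a + e -> 0 < M r)
  (n0 : forall r : R, a - e < r < a + e -> 0 < r - rm2)
  (h0 : forall r, 0 < h r).
Hypotheses
  (dS : forall r : R, a - e < r < a + e -> is_derive r 1 S (h r / a * q r))
  (srho : smooth_on `]- d, d[ rho)
  (rhoS : forall r : R, a - e < r < a + e -> rho (S r) = r)
  (Srho : forall y : R, - d < y < d -> a - e < rho y < a + e /\ S (rho y) = y).

Let N := Nfun a rm2.
(** The bound 1 gives [|U V| <= |V| < d] on [W], so [rho] is defined and smooth at [U V]. *)
Let delta := Num.min 1 d.
Let D := exterior a e.
Let W : set 'rV[R]_5 := bif_nbhd delta.
(** The logarithm of [U] for [s = 1] and of [V] for [s = -1], fixed by [U V = S] and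
    [U / V = expR (k t)]. *)
Let expo (s : R) (x : 'rV[R]_5) := (s * k * x 0 iT + ln (S (x 0 iR))) / 2.
(* [U] and [V] are opaque: were they transparent, matching ['d U] against ['d V]
   would compare real exponentials by conversion. *)
Context (U V : 'rV[R]_5 -> R).
Hypotheses (UE : U = fun x => expR (expo 1 x))
  (VE : V = fun x => expR (expo (-1) x)).
Let Phi (x : 'rV[R]_5) := x 0 iphi - varpi a * x 0 iT.
Let Psi (x : 'rV[R]_5) := x 0 ipsi - varpi a * x 0 iT.
Let chi := chart U V Phi Psi.
Let dchi := dchart U V Phi Psi.

(** * Differentials of the coordinates on the exterior *)

Let an : a != 0. Proof. by rewrite gt_eqF. Qed.
Let kn : k != 0. Proof. by rewrite gt_eqF. Qed.

Let DI x : D x -> a - e < x 0 iR < a + e.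
Proof. by move=> [/andP[ax ->] _]; rewrite andbT (lt_trans _ ax)// ltrBlDr ltrDl. Qed.

Let S_gt0 r : a < r -> 0 < S r.
Proof. by move=> ar; rewrite /S mulr_gt0// subr_gt0 ltr_pdivlMr// mul1r. Qed.

Let DS x : D x -> 0 < S (x 0 iR).
Proof. by move=> [/andP[/S_gt0]]. Qed.

Lemma kruskal_product x : D x -> U x * V x = S (x 0 iR).
Proof.
move=> Dx; rewrite UE VE -expRD (_ : _ + _ = ln (S (x 0 iR))).
  by rewrite lnK// posrE DS.
by rewrite /expo; field.
Qed.

Let is_diff_expo s x : D x -> is_diff x (expo s)
  (fun v => (s * k * v 0 iT + q (x 0 iR) / (x 0 iR - a) * v 0 iR) / 2).
Proof.
move=> Dx; have [/andP[ax _] _] := Dx.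
(* The derivative [h q / a] of [S] is divided by [S = (r - a) h / a]. *)
have dlnS : is_derive (x 0 iR) 1 (fun r => ln (S r)) (q (x 0 iR) / (x 0 iR - a)).
  have dlnSr := is_derive1_ln (DS Dx).
  apply: (is_derive_eq (is_derive1_comp dlnSr (dS (DI Dx)))).
  have ra : x 0 iR - a != 0 by rewrite subr_eq0 gt_eqF.
  have hn : h (x 0 iR) != 0 by rewrite gt_eqF.
  rewrite /S; by field; rewrite ra an hn.
have d1 := is_diff_comp1 dlnS (is_diff_coord iR x).
have d2 := is_diffZ (s * k) (is_diff_coord iT x).
have d3 := is_diffZ 2^-1 (is_diffD d2 d1).
have -> : expo s = 2^-1 \*: ((s * k) \*: (fun y : 'rV[R]_5 => y 0 iT) +
    (fun y : 'rV[R]_5 => ln (S (y 0 iR)))).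
  by apply/funext => y; rewrite /expo mulrC.
apply: (is_diff_eq d3).
by apply/funext => v; rewrite [RHS]mulrC.
Qed.

Let U_gt0 x : 0 < U x. Proof. by rewrite UE expR_gt0. Qed.

Let V_gt0 x : 0 < V x. Proof. by rewrite VE expR_gt0. Qed.

Let dU x v : D x ->
  'd U x v = U x * ((k * v 0 iT + q (x 0 iR) / (x 0 iR - a) * v 0 iR) / 2).
Proof.
move=> Dx; rewrite UE.
have [_ ->] := is_diff_comp1 (is_derive_expR (expo 1 x)) (is_diff_expo 1 Dx).
by rewrite mul1r.
Qed.

Let dV x v : D x ->
  'd V x v = V x * ((- k * v 0 iT + q (x 0 iR) / (x 0 iR - a) * v 0 iR) / 2).
Proof.
move=> Dx; rewrite VE.
have [_ ->] := is_diff_comp1 (is_derive_expR (expo (-1) x)) (is_diff_expo (-1) Dx).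
by rewrite mulN1r.
Qed.

Let dangle (j : 'I_5) (x v : 'rV[R]_5) :
  'd (fun y : 'rV[R]_5 => y 0 j - varpi a * y 0 iT) x v = v 0 j - varpi a * v 0 iT.
Proof.
have [_ dE] := is_diffB (is_diff_coord j x) (is_diffZ (varpi a) (is_diff_coord iT x)).
have -> : (fun y : 'rV[R]_5 => y 0 j - varpi a * y 0 iT) =
  (fun y => y 0 j) - varpi a \*: (fun y => y 0 iT) by [].
by rewrite dE.
Qed.

(** The factor [r - a] cancels in [m / N], and the one in [f] supplies the denominator. *)
Let q_sqrt x : D x -> q (x 0 iR) / (x 0 iR - a) =
  k * Num.sqrt (m (x 0 iR) / N (x 0 iR)) / (2 * f (x 0 iR)).
Proof.
move=> Dx; have [/andP[ax _] _] := Dx; move: (DI Dx) ax; move: (x 0 iR) => r rI ar.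
have ra : r - a != 0 by rewrite subr_eq0 gt_eqF.
have Fn : F r != 0 by rewrite gt_eqF ?F0.
have nn : r - rm2 != 0 by rewrite gt_eqF ?n0.
have -> : m r / N r = M r / (r - rm2).
  by rewrite mE /N /Nfun; field; rewrite ra nn.
by rewrite /q fE; field; rewrite ra Fn.
Qed.

Lemma kruskal_coordinate_equations :
  k = kappa a N f m -> coordinate_equations a N f m varpi D U V Phi Psi.
Proof.
move=> kE; rewrite /coordinate_equations -kE => x Dx; split=> //.
have Un : U x != 0 by rewrite gt_eqF.
have Vn : V x != 0 by rewrite gt_eqF.
have [/andP[ax _] _] := Dx.
have fn : f (x 0 iR) != 0.
  by rewrite fE mulf_neq0// gt_eqF ?subr_gt0// F0// DI.
move=> v; split; [| |exact: dangle|exact: dangle].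
  rewrite (dU v Dx) (dV v Dx) (q_sqrt Dx).
  move: fn Un Vn; move: (f _) (U x) (V x) (Num.sqrt _) => y u u' z y0 u0 u0'.
  by field; rewrite y0 u0 u0'.
rewrite (dU v Dx) (dV v Dx) (q_sqrt Dx).
move: fn Un Vn; move: (f _) (U x) (V x) (Num.sqrt _) => y u u' z y0 u0 u0'.
by field; rewrite y0 u0 u0'.
Qed.

(** * The metric in the new coordinates *)

Let I : set R := `]a - e, a + e[.
Let rr (p : 'rV[R]_5) := rho (p 0 iU * p 0 iV).
(** [E] is the coefficient of [dU dV]. For [r != a], [C] is [m / f] and [B] is [N / m] with [r - a]
    cancelled, so [C - B] is [(m^2 - f N) / (m f)]. *)
Let E r := 4 * a * F r / (k ^+ 2 * h r).
Let C r := M r / F r.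
Let B r := (r - rm2) / M r.
(** Chosen so that [beta tau = (r - a) w dt], the part of [varpi dt] left after subtracting its
    horizon value, as [tau = k S dt]. *)
Let beta r := a * w r / (h r * k).
Let tau (p v : 'rV[R]_5) := p 0 iV * v 0 iU - p 0 iU * v 0 iV.
Let mu j (p v : 'rV[R]_5) := v 0 j - beta (rr p) * tau p v.

(* On the exterior, [mu iPhi], [mu iPsi] and [tau] are dphi - varpi dt,
   dpsi - varpi dt and k (U V) dt. *)
Definition kruskal_form (p u v : 'rV[R]_5) : R :=
  let r := rr p in
  let s := sin (p 0 iTheta) in
  let c := cos (p 0 iTheta) in
  E r / 2 * (u 0 iU * v 0 iV + u 0 iV * v 0 iU)
  + C r * (u 0 iTheta * v 0 iTheta)
  + B r * (s ^+ 2 * (mu iPhi p u * mu iPhi p v)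
           + c ^+ 2 * (mu iPsi p u * mu iPsi p v))
  + (C r - B r) * (s ^+ 2 * c ^+ 2 * ((mu iPhi p u - mu iPsi p u) *
                                      (mu iPhi p v - mu iPsi p v))).

Definition kruskal_matrix (p : 'rV[R]_5) : 'M[R]_5 :=
  \matrix_(i, j) kruskal_form p (delta_mx 0 i) (delta_mx 0 j).

Lemma kruskal_formC p u v : kruskal_form p u v = kruskal_form p v u.
Proof. by rewrite /kruskal_form; ring. Qed.

Lemma kruskal_matrixE p u v :
  (u *m kruskal_matrix p *m v^T) 0 0 = kruskal_form p u v.
Proof.
apply: bilinear_mxE => [c x y z|]; last exact: kruskal_formC.
by rewrite /kruskal_form /mu /tau !mxE; ring.
Qed.

Let W_product p : W p -> - d < p 0 iU * p 0 iV < d.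
Proof.
move=> [pU pV]; rewrite -ltr_norml normrM.
apply: (@le_lt_trans _ _ `|p 0 iV|).
  by rewrite ler_piMl// ltW// (lt_le_trans pU)// ge_min lexx.
by rewrite (lt_le_trans pV)// ge_min lexx orbT.
Qed.

Let rrI p : W p -> a - e < rr p < a + e.
Proof. by move=> /W_product /Srho[]. Qed.

Let S_rr p : W p -> S (rr p) = p 0 iU * p 0 iV.
Proof. by move=> /W_product /Srho[]. Qed.

Let oI : open I. Proof. exact: interval_open. Qed.

Let oW : open W. Proof. exact: open_bif_nbhd. Qed.

Let smooth_rr : smooth_on W rr.
Proof.
apply: (@smooth_on_comp _ _ _ [set` `]- d, d[]) => //.
by apply: smooth_onM => //; exact: smooth_on_coord.
Qed.

Let smooth_comp_rr u : smooth_on I u -> smooth_on W (fun p => u (rr p)).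
Proof. exact: smooth_on_comp oW rrI smooth_rr. Qed.

Let In (u : R -> R) :
  (forall r : R, a - e < r < a + e -> 0 < u r) -> forall r, I r -> u r != 0.
Proof. by move=> u0 r; rewrite /I /= in_itv/= => /u0 /lt0r_neq0. Qed.

Let smooth_E : smooth_on I E.
Proof.
apply: smooth_on_div => //; [|apply: smooth_onM => //; exact: smooth_on_cst..].
by move=> r _; rewrite mulf_neq0 ?expf_neq0// gt_eqF.
Qed.

Let smooth_C : smooth_on I C.
Proof. by apply: smooth_on_div => //; exact: In. Qed.

Let smooth_B : smooth_on I B.
Proof.
apply: smooth_on_div => //; first exact: In.
by apply: smooth_onB => //; [exact: smooth_on_id|exact: smooth_on_cst].
Qed.

Let smooth_beta : smooth_on I beta.
Proof.
apply: smooth_on_div => //; [|apply: smooth_onM => //; exact: smooth_on_cst..].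
by move=> r _; rewrite mulf_neq0// gt_eqF.
Qed.

Lemma smooth_kruskal_form u v : smooth_on W (fun p => kruskal_form p u v).
Proof.
have sE := smooth_comp_rr smooth_E; have sC := smooth_comp_rr smooth_C.
have sB := smooth_comp_rr smooth_B; have sbeta := smooth_comp_rr smooth_beta.
have smu j z : smooth_on W (fun p => mu j p z).
  apply: smooth_onB => //; first exact: smooth_on_cst.
  apply: smooth_onM => //; apply: smooth_onB => //.
    by apply: smooth_onM => //; [exact: smooth_on_coord|exact: smooth_on_cst].
  by apply: smooth_onM => //; [exact: smooth_on_coord|exact: smooth_on_cst].
have ss : smooth_on W (fun p => sin (p 0 iTheta)).
  by apply: smooth_on_comp_sin => //; exact: smooth_on_coord.
have sc : smooth_on W (fun p => cos (p 0 iTheta)).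
  by apply: smooth_on_comp_cos => //; exact: smooth_on_coord.
have sk c := smooth_on_cst W (c : R).
rewrite /kruskal_form.
repeat first [exact: oW | exact: sE | exact: sC | exact: sB | exact: smu
  | exact: ss | exact: sc | exact: sk
  | apply: smooth_onD | apply: smooth_onN | apply: smooth_onX | apply: smooth_onM].
Qed.

Let chiE x : D x -> rr (chi x) = x 0 iR.
Proof.
move=> Dx; rewrite /rr /chi /chart !mxE /= kruskal_product//.
by rewrite rhoS// DI.
Qed.

(** [V dU - U dV] is [U V] times the differential of [ln (U / V) = k t]. *)
Let tau_chi x v : D x ->
  tau (chi x) (dchi x v) = S (x 0 iR) * k * v 0 iT.
Proof.
move=> Dx; rewrite /tau /chi /dchi /chart /dchart !mxE /= (dU v Dx) (dV v Dx).
rewrite -kruskal_product//.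
by move: (U x) (V x) (_ / _ * v 0 iR) => u u' z; field.
Qed.

Let mu_chi j x v : D x -> dchi x v 0 j = v 0 j - varpi a * v 0 iT ->
  mu j (chi x) (dchi x v) = v 0 j - varpi (x 0 iR) * v 0 iT.
Proof.
move=> Dx vj; rewrite /mu vj chiE// tau_chi//.
rewrite /beta /S (varpiE (x 0 iR)).
have := h0 (x 0 iR); move: (h _) (v 0 iT) => y z /lt0r_neq0 yn.
by field; rewrite an yn kn.
Qed.

Lemma kruskal_form_pullback x v : D x ->
  ds2 N f m varpi x v = kruskal_form (chi x) (dchi x v) (dchi x v).
Proof.
move=> Dx; have [/andP[ax _] _] := Dx; have xI := DI Dx.
have ra : x 0 iR - a != 0 by rewrite subr_eq0 gt_eqF.
have Fn : F (x 0 iR) != 0 by rewrite gt_eqF ?F0.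
have Mn : M (x 0 iR) != 0 by rewrite gt_eqF ?M0.
have nn : x 0 iR - rm2 != 0 by rewrite gt_eqF ?n0.
have dPhi : dchi x v 0 iPhi = v 0 iphi - varpi a * v 0 iT.
  by rewrite /dchi /dchart mxE /= dangle.
have dPsi : dchi x v 0 iPsi = v 0 ipsi - varpi a * v 0 iT.
  by rewrite /dchi /dchart mxE /= dangle.
rewrite /kruskal_form (mu_chi Dx dPhi) (mu_chi Dx dPsi) (chiE Dx).
have -> : dchi x v 0 iTheta = v 0 iTheta by rewrite mxE.
have -> : chi x 0 iTheta = x 0 iTheta by rewrite mxE.
(* The logarithmic differentials of [U] and [V] are half the sum and half the difference of
   [q dR / (R - a)] and [k dt], so their product is a difference of squares. *)
have -> : dchi x v 0 iU * dchi x v 0 iV + dchi x v 0 iV * dchi x v 0 iU =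
    U x * V x * ((q (x 0 iR) / (x 0 iR - a)) ^+ 2 * v 0 iR ^+ 2
                 - k ^+ 2 * v 0 iT ^+ 2) / 2.
  rewrite /dchi /dchart !mxE /= (dU v Dx) (dV v Dx).
  by move: (U x) (V x) (q _ / (_ - a)) => u u' z; field.
(* Only the square of [q] enters the metric, which removes the square root. *)
have q2 : (q (x 0 iR) / (x 0 iR - a)) ^+ 2 =
    k ^+ 2 * M (x 0 iR) / (4 * (x 0 iR - rm2) * F (x 0 iR) ^+ 2 * (x 0 iR - a) ^+ 2).
  have Mnn : 0 <= M (x 0 iR) / (x 0 iR - rm2).
    by apply: ltW; rewrite divr_gt0 ?M0 ?n0.
  rewrite /q !expr_div_n !exprMn sqr_sqrtr//.
  by field; rewrite ra Fn nn.
rewrite q2 kruskal_product// /ds2 /E /B /C /S /N /Nfun !fE !mE.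
move: ra Fn Mn nn (lt0r_neq0 (h0 (x 0 iR))).
move: (sin _) (cos _) (v 0 iR) (v 0 iT) (v 0 iphi) (v 0 ipsi) (v 0 iTheta) (varpi _).
move: (x 0 iR) (F _) (M _) (h _) => r F1 M1 h1 s c vR vT vphi vpsi vth vp.
move=> ra Fn Mn nn hn; field.
by rewrite an kn ra Fn Mn nn hn.
Qed.

(** [S a = 0] and [rho] inverts [S], so the radius is [a] exactly where [U V = 0]. *)
Let rr_S0 p : W p -> (rr p = a <-> p 0 iU = 0 \/ p 0 iV = 0).
Proof.
move=> Wp; have Sr := S_rr Wp.
have Sa : S a = 0 by rewrite /S divff// subrr mul0r.
split=> [ra|pUV].
  move: Sr; rewrite ra Sa => /esym/eqP.
  by rewrite mulf_eq0 => /orP[/eqP|/eqP]; [left|right].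
have pUV0 : p 0 iU * p 0 iV = 0 by case: pUV => ->; rewrite ?mul0r ?mulr0.
by rewrite /rr pUV0 -Sa rhoS// ltrDl e0 ltrBlDr ltrDl e0.
Qed.

Let shift_coord (x : 'rV[R]_5) c (i j : 'I_5) : i != j ->
  (x + c *: delta_mx 0 j) 0 i = x 0 i.
Proof. by move=> /negbTE ij; rewrite !mxE ij andbF mulr0 addr0. Qed.

Let periodic_rr : angle_periodic rr.
Proof. by move=> x; rewrite /rr !shift_coord. Qed.

Lemma kruskal_matrix_periodic : angle_periodic kruskal_matrix.
Proof.
move=> x; have [r1 r2] := periodic_rr x.
split; apply/matrixP => i j; rewrite !mxE /kruskal_form /mu /tau ?r1 ?r2.
  by rewrite !(@shift_coord _ _ _ iphi).
by rewrite !(@shift_coord _ _ _ ipsi).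
Qed.

Let B_gt0 p : W p -> 0 < B (rr p).
Proof. by move=> /rrI pI; rewrite divr_gt0 ?M0 ?n0. Qed.

Let C_gt0 p : W p -> 0 < C (rr p).
Proof. by move=> /rrI pI; rewrite divr_gt0 ?M0 ?F0. Qed.

Let E_gt0 p : W p -> 0 < E (rr p).
Proof.
by move=> /rrI pI; rewrite divr_gt0// !mulr_gt0 ?F0// exprn_gt0.
Qed.

Let kruskal_form_vec5 p v (wu wv wt wp wq : R) :
  kruskal_form p v (vec5 wu wv wt wp wq) =
  E (rr p) / 2 * (v 0 iU * wv + v 0 iV * wu) + C (rr p) * (v 0 iTheta * wt)
  + B (rr p) * (sin (p 0 iTheta) ^+ 2 * (mu iPhi p v *
        (wp - beta (rr p) * (p 0 iV * wu - p 0 iU * wv)))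
      + cos (p 0 iTheta) ^+ 2 * (mu iPsi p v *
        (wq - beta (rr p) * (p 0 iV * wu - p 0 iU * wv))))
  + (C (rr p) - B (rr p)) * (sin (p 0 iTheta) ^+ 2 * cos (p 0 iTheta) ^+ 2 *
      ((mu iPhi p v - mu iPsi p v) * (wp - wq))).
Proof.
rewrite /kruskal_form; set mP := mu iPhi p v; set mQ := mu iPsi p v.
rewrite /mu /tau !mxE /=; ring.
Qed.

(** A kernel vector has no [U], [V] or [theta] component; [tau] then vanishes on it, so [mu] reduces
    to the angular components, which vanish as well. *)
Lemma kruskal_matrix_nondegenerate p : W p -> 0 < p 0 iTheta < pi / 2 ->
  \det (kruskal_matrix p) != 0.
Proof.
move=> Wp /andP[th0 th1]; apply/negP => /det0P[v v0 vG].
have key wu wv wt wp wq : kruskal_form p v (vec5 wu wv wt wp wq) = 0.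
  by rewrite -kruskal_matrixE vG mul0mx mxE.
have s0 : sin (p 0 iTheta) != 0.
  rewrite gt_eqF// sin_gt0_pi// th0/= (lt_trans th1)//.
  by rewrite ltr_pdivrMr// ltr_pMr ?pi_gt0// ltr1n.
have c0 : cos (p 0 iTheta) != 0.
  rewrite gt_eqF// cos_gt0_pihalf// th1 andbT (lt_trans _ th0)//.
  by rewrite oppr_lt0 divr_gt0 ?pi_gt0.
have sc1 := cos2Dsin2 (p 0 iTheta).
have Bn := lt0r_neq0 (B_gt0 Wp); have Cn := lt0r_neq0 (C_gt0 Wp).
have En := lt0r_neq0 (E_gt0 Wp).
have [vU vV vt vP vQ] : [/\ v 0 iU = 0, v 0 iV = 0, v 0 iTheta = 0,
    mu iPhi p v = 0 & mu iPsi p v = 0].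
  apply: (kernel_null_form (beta := beta (rr p)) (pU := p 0 iU) (pV := p 0 iV)
    En Cn Bn s0 c0 sc1) => wu wv wt wp wq.
  by rewrite -kruskal_form_vec5.
have tau0 : tau p v = 0 by rewrite /tau vU vV !mulr0 subrr.
move: vP vQ; rewrite /mu tau0 mulr0 !subr0 => vP vQ.
by move/eqP: v0; apply; apply: vec5P; rewrite mxE.
Qed.


Lemma kruskal_metric_extends :
  metric_extends (ds2 N f m varpi) D W chi dchi kruskal_matrix.
Proof.
split.
- move=> i j.
  apply: smooth_on_eq (smooth_kruskal_form (delta_mx 0 i) (delta_mx 0 j)) => //.
  by move=> p _; rewrite mxE.
- exact: kruskal_matrix_periodic.
- by move=> p _; apply/matrixP => i j; rewrite !mxE kruskal_formC.
- exact: kruskal_matrix_nondegenerate.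
- by move=> x v Dx _; rewrite /qform kruskal_matrixE kruskal_form_pullback.
Qed.

(** * Smoothness of the chart and its inverse on the open quadrant *)

Let smooth_expo s : smooth_on D (expo s).
Proof.
have oD : open D by exact: open_exterior.
have sS : smooth_on I S.
  apply: smooth_onM => //; apply: smooth_onB => //; last exact: smooth_on_cst.
  by apply: smooth_onM => //; [exact: smooth_on_id|exact: smooth_on_cst].
apply: smooth_onM => //; last exact: smooth_on_cst.
apply: smooth_onD => //.
  by apply: smooth_onM => //; [exact: smooth_on_cst|exact: smooth_on_coord].
apply: smooth_on_comp_ln => //.
by apply: smooth_on_comp sS => //; exact: smooth_on_coord.
Qed.

Lemma smooth_kruskal_coordinates :
  [/\ smooth_on D U, smooth_on D V, smooth_on D Phi & smooth_on D Psi].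
Proof.
have oD : open D by exact: open_exterior.
have sang (j : 'I_5) : smooth_on D (fun x => x 0 j - varpi a * x 0 iT).
  apply: smooth_onB => //; first exact: smooth_on_coord.
  by apply: smooth_onM => //; [exact: smooth_on_cst|exact: smooth_on_coord].
rewrite UE VE.
by split; [apply: smooth_on_comp_expR|apply: smooth_on_comp_expR|exact: sang..].
Qed.

(** Time is recovered from [U / V], the radius from [U V], and the angles by undoing the
    corotation. *)
Let inv_chi (p : 'rV[R]_5) : 'rV[R]_5 :=
  let t := ln (p 0 iU / p 0 iV) / k in
  vec5 t (rr p) (p 0 iTheta) (p 0 iPhi + varpi a * t) (p 0 iPsi + varpi a * t).

Let inv_chiP p : W p -> 0 < p 0 iU -> 0 < p 0 iV -> 0 < p 0 iTheta < pi / 2 ->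
  D (inv_chi p) /\ chi (inv_chi p) = p.
Proof.
move=> Wp pU pV pth; have Sr := S_rr Wp; have /andP[_ re] := rrI Wp.
(* Since [h] is positive, [S r] has the sign of [r - a], and here it equals [U V > 0]. *)
have ar : a < rr p.
  have : 0 < S (rr p) by rewrite Sr mulr_gt0.
  by rewrite /S pmulr_lgt0// subr_gt0 ltr_pdivlMr// mul1r.
split; first by rewrite /D /exterior /inv_chi /= !mxE /= ar re.
have UVE s : expo s (inv_chi p) =
    (s * (ln (p 0 iU) - ln (p 0 iV)) + (ln (p 0 iU) + ln (p 0 iV))) / 2.
  rewrite /expo /inv_chi !mxE /= Sr ln_div ?posrE// lnM ?posrE//.
  by congr (_ / 2); congr (_ + _); field.
apply: vec5P; rewrite /chi /chart mxE //=.
- rewrite UE UVE (_ : _ / 2 = ln (p 0 iU)) ?lnK ?posrE//; by field.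
- rewrite VE UVE (_ : _ / 2 = ln (p 0 iV)) ?lnK ?posrE//; by field.
- by rewrite mxE.
- by rewrite /Phi /inv_chi !mxE /= addrK.
- by rewrite /Psi /inv_chi !mxE /= addrK.
Qed.

Lemma kruskal_chart_onto p : W p -> 0 < p 0 iU -> 0 < p 0 iV ->
  0 < p 0 iTheta < pi / 2 -> exists2 x, D x & chi x = p.
Proof.
by move=> Wp pU pV pth; have [] := inv_chiP Wp pU pV pth; exists (inv_chi p).
Qed.

(** * The future and past horizons *)

Lemma null_U p : W p -> p 0 iU = 0 ->
  null_coordinate_hypersurface iU (kruskal_matrix p).
Proof.
(* The null direction is that of [V]: [tau] vanishes on it where [U = 0], leaving only its pairing
   with [dU], which is zero on tangent vectors. *)
move=> Wp pU; exists (vec5 0 1 0 0 0); split; [|by rewrite mxE|].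
  by apply/eqP => /rowP/(_ iV); rewrite !mxE /= => /eqP; rewrite oner_eq0.
by move=> z zU; rewrite kruskal_matrixE kruskal_formC kruskal_form_vec5 zU pU; ring.
Qed.

Lemma null_V p : W p -> p 0 iV = 0 ->
  null_coordinate_hypersurface iV (kruskal_matrix p).
Proof.
move=> Wp pV; exists (vec5 1 0 0 0 0); split; [|by rewrite mxE|].
  by apply/eqP => /rowP/(_ iU); rewrite !mxE /= => /eqP; rewrite oner_eq0.
by move=> z zV; rewrite kruskal_matrixE kruskal_formC kruskal_form_vec5 zV pV; ring.
Qed.

(** The sequence is pulled back by [inv_chi]; its radii tend to [a] by continuity of [rr] at [p]. *)
Let reach_horizon p (pn : nat -> 'rV[R]_5) (tlim : set_system R) :
  W p -> rr p = a -> pn @ \oo --> p ->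
  (forall n, [/\ 0 < pn n 0 iU < delta, 0 < pn n 0 iV < delta &
    0 < pn n 0 iTheta < pi / 2]) ->
  (fun n => ln (pn n 0 iU / pn n 0 iV) / k) @ \oo --> tlim ->
  horizon a D chi tlim p.
Proof.
move=> Wp rpa cpn pnP ct.
have inv_pn n : D (inv_chi (pn n)) /\ chi (inv_chi (pn n)) = pn n.
  have [/andP[u0 ud] /andP[v0 vd] th] := pnP n.
  apply: inv_chiP => //; split; by rewrite gtr0_norm.
exists (fun n => inv_chi (pn n)); split.
- by move=> n; have [] := inv_pn n.
- rewrite (_ : (fun n => _) = (fun n => ln (pn n 0 iU / pn n 0 iV) / k))//.
  by apply/funext => n; rewrite mxE.
- rewrite (_ : (fun n => _) = rr \o pn); last by apply/funext => n; rewrite mxE.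
  rewrite -rpa; apply: cvg_comp cpn _.
  exact: differentiable_continuous (smooth_on_differentiable smooth_rr Wp).
- rewrite (_ : (fun n => _) = pn)//.
  by apply/funext => n; have [] := inv_pn n.
Qed.

Let chi_cvg (j : 'I_5) (p : 'rV[R]_5) (x : nat -> 'rV[R]_5) :
  (fun n => chi (x n)) @ \oo --> p -> (fun n => chi (x n) 0 j) @ \oo --> p 0 j.
Proof. by move=> cx; exact: cvg_comp cx (@continuous_coord _ _ j p). Qed.

Let chi_cvgUV (p : 'rV[R]_5) (x : nat -> 'rV[R]_5) : (fun n => chi (x n)) @ \oo --> p ->
  (fun n => U (x n)) @ \oo --> p 0 iU /\ (fun n => V (x n)) @ \oo --> p 0 iV.
Proof.
move=> cx; split.
  rewrite (_ : (fun n => _) = (fun n => chi (x n) 0 iU)); first exact: chi_cvg.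
  by apply/funext => n; rewrite mxE.
rewrite (_ : (fun n => _) = (fun n => chi (x n) 0 iV)); first exact: chi_cvg.
by apply/funext => n; rewrite mxE.
Qed.

Let V_U x : V x = U x * expR (- (k * x 0 iT)).
Proof. by rewrite UE VE -expRD; congr expR; rewrite /expo; field. Qed.

Let U_V x : U x = V x * expR (- (k * - x 0 iT)).
Proof. by rewrite mulrN opprK UE VE -expRD; congr expR; rewrite /expo; field. Qed.

(** Along a sequence with [t] tending to infinity, [V = U expR (- k t)] tends to 0 because [U]
    converges. Conversely [approach_face] supplies a sequence with times [n / k]. *)
Lemma future_horizonE p : W p -> 0 <= p 0 iTheta <= pi / 2 ->
  horizon a D chi (pinfty_nbhs R) p <-> 0 <= p 0 iU /\ p 0 iV = 0.
Proof.
move=> Wp pth; split=> [[x [Dx ct _ /chi_cvgUV[cU cV]]]|[pU pV]].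
  split; first by apply: cvgr_to_ge cU _; apply: nearW => n; exact: ltW.
  have ckt : (fun n => k * x n 0 iT) @ \oo --> pinfty_nbhs R.
    exact: cvg_pinfty_scale ct.
  have ce : (fun n => expR (- (k * x n 0 iT))) @ \oo --> (0 : R).
    exact: (@cvg_comp _ _ _ (fun n => k * x n 0 iT) (fun y => expR (- y)) _ _ _
      ckt (@cvgr_expR R)).
  have cV0 : (fun n => V (x n)) @ \oo --> (0 : R).
    rewrite (_ : (fun n => _) = (fun n => U (x n) * expR (- (k * x n 0 iT)))).
      rewrite -[X in _ --> X](mulr0 (p 0 iU)); exact: cvgM cU ce.
    by apply/funext => n; rewrite V_U.
  exact: cvg_unique cV cV0.
have [||||||pn cpn pnP] := @approach_face _ delta iU iV p => //.
  by have [pUd _] := Wp; rewrite pU (le_lt_trans (ler_norm _)).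
apply: (reach_horizon Wp _ cpn); first by apply/rr_S0 => //; right.
  by move=> n; have [] := pnP n.
rewrite (_ : (fun n => _) = (fun n => k^-1 * n%:R)).
  by apply: cvg_pinfty_scale; [rewrite invr_gt0|exact: cvgr_idn].
by apply/funext => n; have [_ _ _ ->] := pnP n; rewrite expRK mulrC.
Qed.

Lemma past_horizonE p : W p -> 0 <= p 0 iTheta <= pi / 2 ->
  horizon a D chi (ninfty_nbhs R) p <-> p 0 iU = 0 /\ 0 <= p 0 iV.
Proof.
move=> Wp pth; split=> [[x [Dx ct _ /chi_cvgUV[cU cV]]]|[pU pV]].
  split; last by apply: cvgr_to_ge cV _; apply: nearW => n; exact: ltW.
  have ckt : (fun n => k * - x n 0 iT) @ \oo --> pinfty_nbhs R.
    exact: cvg_pinfty_scaleN ct.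
  have ce : (fun n => expR (- (k * - x n 0 iT))) @ \oo --> (0 : R).
    exact: (@cvg_comp _ _ _ (fun n => k * - x n 0 iT) (fun y => expR (- y)) _ _ _
      ckt (@cvgr_expR R)).
  have cU0 : (fun n => U (x n)) @ \oo --> (0 : R).
    rewrite (_ : (fun n => _) = (fun n => V (x n) * expR (- (k * - x n 0 iT)))).
      rewrite -[X in _ --> X](mulr0 (p 0 iV)); exact: cvgM cV ce.
    by apply/funext => n; rewrite U_V.
  exact: cvg_unique cU cU0.
have [||||||pn cpn pnP] := @approach_face _ delta iV iU p => //.
  by have [_ pVd] := Wp; rewrite pV (le_lt_trans (ler_norm _)).
apply: (reach_horizon Wp _ cpn); first by apply/rr_S0 => //; left.
  by move=> n; have [] := pnP n.
(* With the roles of [U] and [V] exchanged, [V / U = expR n%:R] and the times are [- n / k]. *)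
rewrite (_ : (fun n => _) = (- (fun n => k^-1 * n%:R))).
  by apply/cvgNrNy; apply: cvg_pinfty_scale; [rewrite invr_gt0|exact: cvgr_idn].
apply/funext => n; have [_ _ _ pnE] := pnP n.
by rewrite -(invf_div (pn n 0 iV)) pnE -expRN expRK mulNr mulrC.
Qed.

Lemma kruskal_horizons : horizons_meet_at_bifurcation a D W chi kruskal_matrix.
Proof.
split; last split.
- exists rr; split; [exact: smooth_rr|exact: periodic_rr| |exact: @rr_S0].
  by move=> x Dx _; exact: chiE.
- move=> p Wp pth.
  have hf := future_horizonE Wp pth; have hp := past_horizonE Wp pth.
  split; [exact: hf|exact: hp|split].
    by move=> [/hf[_ ->] /hp[-> _]].
  by move=> [pU pV]; split; [apply/hf|apply/hp]; rewrite pU pV lexx.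
- by move=> p Wp; split; [exact: null_U|exact: null_V].
Qed.

(** * The potential up to an exact form *)

(** As [sin^2 + cos^2 = 1], passing to [dPhi] and [dPsi] turns the coefficient of [dt] into
    [a0f + aphi varpi(a)], whose value at the horizon is removed by the exact form. *)
Lemma kruskal_potential (a0f aphi b : R -> R) :
  smooth_on I aphi -> smooth_on I b ->
  (forall r, a0f r + aphi r * varpi a = a0f a + aphi a * varpi a + (r - a) * b r) ->
  potential_extends_up_to_exact (potential a0f aphi) D W chi dchi.
Proof.
move=> saphi sb bE.
pose c0 := a0f a + aphi a * varpi a.
(* Chosen so that [gam tau = (r - a) b dt], by [tau = k S dt]. *)
pose gam r := a * b r / (h r * k).
have sgam : smooth_on I gam.
  apply: smooth_on_div => //; [|apply: smooth_onM => //; exact: smooth_on_cst..].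
  by move=> r _; rewrite mulf_neq0// gt_eqF.
pose Bf (p : 'rV[R]_5) : 'rV[R]_5 := vec5 (gam (rr p) * p 0 iV)
  (- (gam (rr p) * p 0 iU)) 0 (aphi (rr p) * sin (p 0 iTheta) ^+ 2)
  (aphi (rr p) * cos (p 0 iTheta) ^+ 2).
exists (fun x => c0 * x 0 iT), Bf; split.
- apply: smooth_onM; [exact: open_exterior|exact: smooth_on_cst|exact: smooth_on_coord].
- by move=> x; rewrite !shift_coord.
- have sg := smooth_comp_rr sgam; have sa := smooth_comp_rr saphi.
  have sc j : smooth_on W (fun p : 'rV[R]_5 => p 0 j) by exact: smooth_on_coord.
  move=> i; have -> : (fun p => Bf p 0 i) = (fun p => [:: gam (rr p) * p 0 iV;
      - (gam (rr p) * p 0 iU); 0; aphi (rr p) * sin (p 0 iTheta) ^+ 2;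
      aphi (rr p) * cos (p 0 iTheta) ^+ 2]`_i).
    by apply/funext => p; rewrite mxE.
  case: i => -[|[|[|[|[|//]]]]] _ /=.
  + by apply: smooth_onM.
  + by apply: smooth_onN => //; apply: smooth_onM.
  + exact: smooth_on_cst.
  + by apply: smooth_onM => //; apply: smooth_onX => //; exact: smooth_on_comp_sin.
  + by apply: smooth_onM => //; apply: smooth_onX => //; exact: smooth_on_comp_cos.
- by move=> x; have [r1 r2] := periodic_rr x; split; rewrite /Bf ?r1 ?r2 !shift_coord.
- move=> x v Dx _.
  have [_ dl] := is_diffZ c0 (is_diff_coord iT x).
  have -> : 'd (fun x : 'rV[R]_5 => c0 * x 0 iT) x v = c0 * v 0 iT.
    by rewrite [LHS](congr1 (@^~ v) dl).
  have sumE (T : 'I_5 -> R) :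
      \sum_i T i = T iU + T iV + T iTheta + T iPhi + T iPsi.
    rewrite !big_ord_recl big_ord0 addr0 !addrA.
    by do 4?congr (_ + _); congr T; apply: val_inj.
  have dPhi : dchi x v 0 iPhi = v 0 iphi - varpi a * v 0 iT.
    by rewrite /dchi /dchart mxE /= dangle.
  have dPsi : dchi x v 0 iPsi = v 0 ipsi - varpi a * v 0 iT.
    by rewrite /dchi /dchart mxE /= dangle.
  have BE i : Bf (chi x) 0 i = [:: gam (x 0 iR) * chi x 0 iV;
      - (gam (x 0 iR) * chi x 0 iU); 0; aphi (x 0 iR) * sin (x 0 iTheta) ^+ 2;
      aphi (x 0 iR) * cos (x 0 iTheta) ^+ 2]`_i.
    rewrite /Bf chiE// mxE.
    by have -> : chi x 0 iTheta = x 0 iTheta by rewrite mxE.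
  rewrite sumE !BE /= dPhi dPsi mul0r addr0.
  have -> : gam (x 0 iR) * chi x 0 iV * dchi x v 0 iU
      + - (gam (x 0 iR) * chi x 0 iU) * dchi x v 0 iV
      = (x 0 iR - a) * b (x 0 iR) * v 0 iT.
    transitivity (gam (x 0 iR) * tau (chi x) (dchi x v)).
      by rewrite /tau; ring.
    rewrite tau_chi// /gam /S; have := lt0r_neq0 (h0 (x 0 iR)).
    move: (x 0 iR) (h _) (b _) => r y z yn.
    by field; rewrite an yn kn.
  have -> : (x 0 iR - a) * b (x 0 iR) =
      a0f (x 0 iR) + aphi (x 0 iR) * varpi a - c0 by rewrite bE /c0; ring.
  by rewrite /potential cos2sin2; ring.
Qed.

(** * The extension assembled from the regular data *)

Lemma kruskal_extension (a0f aphi b : R -> R) :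
  k = kappa a N f m -> h a = 1 -> smooth_on I aphi -> smooth_on I b ->
  (forall r, a0f r + aphi r * varpi a = a0f a + aphi a * varpi a + (r - a) * b r) ->
  exists (eps delta : R) (U V Phi Psi : 'rV[R]_5 -> R) (h : R -> R)
         (G : 'rV[R]_5 -> 'M[R]_5),
    let D := exterior a eps in
    let W := bif_nbhd delta in
    let chi := chart U V Phi Psi in
    let dchi := dchart U V Phi Psi in
    [/\ 0 < eps, 0 < delta &
        forall r, a < r < a + eps -> [/\ 0 < f r, 0 < m r & 0 < N r]] /\
    [/\ smooth_on D U, smooth_on D V, smooth_on D Phi & smooth_on D Psi] /\
    coordinate_equations a N f m varpi D U V Phi Psi /\
    (forall p, W p -> 0 < p 0 iU -> 0 < p 0 iV -> 0 < p 0 iTheta < pi / 2 ->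
       exists2 x, D x & chi x = p) /\
    [/\ smooth_near a h,
        h = (fun _ => 1) +O_ (nbhs a) (fun r => r - a) &
        forall x, D x -> U x * V x = (x 0 iR / a - 1) * h (x 0 iR)] /\
    metric_extends (ds2 N f m varpi) D W chi dchi G /\
    horizons_meet_at_bifurcation a D W chi G /\
    potential_extends_up_to_exact (potential a0f aphi) D W chi dchi.
Proof.
move=> kE ha saphi sb bE.
have Ia : I a by rewrite /I /= in_itv/= ltrDl e0 ltrBlDr ltrDl e0.
exists e, delta, U, V, Phi, Psi, h, kruskal_matrix; split.
  split=> // [|r /andP[ar re]]; first by rewrite lt_min ltr01.
  have rI : a - e < r < a + e by rewrite re (lt_trans _ ar)// ltrBlDr ltrDl.
  have ra : 0 < r - a by rewrite subr_gt0.
  rewrite fE mE /N /Nfun; split; apply: mulr_gt0 => //.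
  - exact: F0.
  - exact: M0.
  - exact: n0.
split; first exact: smooth_kruskal_coordinates.
split; first exact: kruskal_coordinate_equations.
split; first exact: kruskal_chart_onto.
split.
  split; [by exists I|by rewrite -ha; exact: smooth_on_bigO oI Ia sh|].
  exact: kruskal_product.
split; first exact: kruskal_metric_extends.
by split; [exact: kruskal_horizons|exact: kruskal_potential bE].
Qed.

End KruskalExtension.

(** * Construction of the regular data from the hypotheses *)

Theorem mainTheorem3 (R : realType) (rp2 rm2 : R) (hr : rm2 < rp2)
    (hp : 0 < rp2) (f m varpi a0 aphi : R -> R) (f1 m1 : R)
    (hf : smooth_near rp2 f) (hm : smooth_near rp2 m)
    (hvarpi : smooth_near rp2 varpi) (ha0 : smooth_near rp2 a0)
    (haphi : smooth_near rp2 aphi) (hf1 : 0 < f1) (hm1 : 0 < m1)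
    (hfO : f = (fun r => f1 * (r - rp2))
             +O_ (nbhs rp2) (fun r => (r - rp2) ^+ 2))
    (hmO : m = (fun r => m1 * (r - rp2))
             +O_ (nbhs rp2) (fun r => (r - rp2) ^+ 2)) :
  let N := Nfun rp2 rm2 in
  let g := ds2 N f m varpi in
  let A := potential a0 aphi in
  exists (eps delta : R) (U V Phi Psi : 'rV[R]_5 -> R) (h : R -> R)
         (G : 'rV[R]_5 -> 'M[R]_5),
    let D := exterior rp2 eps in
    let W := bif_nbhd delta in
    let chi := chart U V Phi Psi in
    let dchi := dchart U V Phi Psi in
    [/\ 0 < eps, 0 < delta &
        forall r, rp2 < r < rp2 + eps -> [/\ 0 < f r, 0 < m r & 0 < N r]] /\
    [/\ smooth_on D U, smooth_on D V, smooth_on D Phi & smooth_on D Psi] /\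
    coordinate_equations rp2 N f m varpi D U V Phi Psi /\
    (forall p, W p -> 0 < p 0 iU -> 0 < p 0 iV -> 0 < p 0 iTheta < pi / 2 ->
       exists2 x, D x & chi x = p) /\
    [/\ smooth_near rp2 h,
        h = (fun _ => 1) +O_ (nbhs rp2) (fun r => r - rp2) &
        forall x, D x -> U x * V x = (x 0 iR / rp2 - 1) * h (x 0 iR)] /\
    metric_extends g D W chi dchi G /\
    horizons_meet_at_bifurcation rp2 D W chi G /\
    potential_extends_up_to_exact A D W chi dchi.
Proof.
move=> N g A.
set a := rp2 in hp hf hm hvarpi ha0 haphi hfO hmO N g A *.
have [fa f'a] := first_order_bigO hfO.
have [ma m'a] := first_order_bigO hmO.
have [Wf [oWf Wfa sf]] := hf; have [Wm [oWm Wma sm]] := hm.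
have [Wv [oWv Wva sv]] := hvarpi; have [W0 [oW0 W0a s0]] := ha0.
have [Wp [oWp Wpa sp]] := haphi.
have [F [sF fE Fa]] := smooth_on_factor oWf Wfa sf fa.
have [M [sM mE Ma]] := smooth_on_factor oWm Wma sm ma.
have sv1 : smooth_on Wv (fun r => varpi r - varpi a).
  by apply: smooth_onB => //; exact: smooth_on_cst.
have [|w [sw wE _]] := smooth_on_factor oWv Wva sv1; first by rewrite subrr.
pose Wb := W0 `&` Wp; have oWb : open Wb by exact: openI.
(* The coefficient of [dt] in the potential once written with [dPhi] and [dPsi]; its increment from
   [a] is divisible by [r - a]. *)
pose b0 r := a0 r + aphi r * varpi a.
have sb0 : smooth_on Wb (fun r => b0 r - b0 a).
  apply: smooth_onB => //; last exact: smooth_on_cst.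
  apply: smooth_onD => //; first by apply: smooth_on_sub s0 => r [].
  apply: smooth_onM => //; last exact: smooth_on_cst.
  by apply: smooth_on_sub sp => r [].
have [|b [sb bE _]] := smooth_on_factor oWb (conj W0a Wpa) sb0.
  by rewrite subrr.
have F0 : 0 < F a by rewrite Fa f'a.
have M0 : 0 < M a by rewrite Ma m'a.
have n0 : 0 < a - rm2 by rewrite subr_gt0.
have near_pos u (W : set R) : open W -> W a -> smooth_on W u -> 0 < u a ->
    nbhs a [set r | W r /\ 0 < u r].
  move=> oW Wa su u0; apply: filterI; first exact: open_nbhs_nbhs.
  by apply: cvgr_gt (is_derive1_continuous (smooth_on_is_derive su Wa)) _ _.
have sn : smooth_on [set: R] (fun r => r - rm2).
  apply: smooth_onB; [exact: openT|exact: smooth_on_id|exact: smooth_on_cst].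
have nF := near_pos F Wf oWf Wfa sF F0.
have nM := near_pos M Wm oWm Wma sM M0.
have nn := near_pos _ [set: R] openT I sn n0.
have nv : nbhs a Wv by exact: open_nbhs_nbhs.
have nb : nbhs a Wb by apply: open_nbhs_nbhs; split.
(* One interval has to serve for all smoothness and positivity conditions at once. *)
pose good r := [/\ Wf r /\ 0 < F r, Wm r /\ 0 < M r, 0 < r - rm2, Wv r & Wb r].
have /nbhs_ballP[e0 /= e00 hW] : nbhs a good.
  apply: filterS (filterI (filterI nF nM) (filterI nn (filterI nv nb))).
  by move=> r [[? ?] [[_ ?] [? ?]]].
pose W : set R := [set` `]a - e0, a + e0[].
have oW : open W by exact: interval_open.
have Wa : W a by rewrite /W /= in_itv/= ltrDl e00 ltrBlDr ltrDl e00.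
have {}hW r : W r -> good r.
  by rewrite /W /= in_itv/= => rW; apply: hW; rewrite /ball/= ltr_distlC.
pose k := kappa a N f m.
pose q r := k / 2 * Num.sqrt (M r / (r - rm2)) / F r.
have dN : derive1 N a = a - rm2.
  have d c : is_derive a 1 (fun r : R => r - c) 1.
    by apply: is_derive_eq; rewrite subr0.
  have [_] := is_deriveM (d a) (d rm2).
  by rewrite -derive1E => ->; rewrite subrr scale0r add0r -[LHS]/(_ * 1) mulr1.
have kE : k = 2 * f1 * Num.sqrt ((a - rm2) / m1) by rewrite /k /kappa dN f'a m'a.
have k0 : 0 < k by rewrite kE !mulr_gt0// sqrtr_gt0 divr_gt0.
(* This is where the value of [kappa] matters: its square root and the one in [q a] are reciprocal,
   and [F a = f1] cancels. *)
have qa : q a = 1.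
  rewrite /q kE Fa f'a Ma m'a.
  have : Num.sqrt ((a - rm2) / m1) * Num.sqrt (m1 / (a - rm2)) = 1.
    rewrite -sqrtrM; last by apply: ltW; rewrite divr_gt0.
    rewrite (_ : _ / _ * _ = 1) ?sqrtr1//; field.
    by rewrite !gt_eqF.
  move: (Num.sqrt _) (Num.sqrt _) => y z yz.
  by rewrite -[RHS]yz; field; rewrite gt_eqF.
have sWF : smooth_on W F by apply: smooth_on_sub sF => r /hW[[]].
have sWM : smooth_on W M by apply: smooth_on_sub sM => r /hW[_ []].
have sq : smooth_on W q.
  apply: smooth_on_div => //; first by move=> r /hW[[_ /lt0r_neq0]].
  apply: smooth_onM => //; first exact: smooth_on_cst.
  apply: smooth_on_comp_sqrt => //.
    by move=> r /hW[_ [_ ?] ? _ _]; rewrite divr_gt0.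
  apply: smooth_on_div => //; last exact: smooth_on_sub sn.
  by move=> r /hW[_ _ /lt0r_neq0].
have [e [d [h [rho [[e0' d0 eW] [sh ha h0] dS [srho rhoS Srho]]]]]] :=
  regular_coordinate hp oW Wa sq qa.
have eW' : [set` `]a - e, a + e[] `<=` good by move=> r /eW /hW.
have eI r : a - e < r < a + e -> good r.
  by move=> rI; apply: eW'; rewrite /= in_itv.
apply: (@kruskal_extension R a rm2 e d k f m varpi F M w h rho hp k0 e0' d0 fE mE
  _ _ _ _ sh _ _ _ h0 dS srho rhoS Srho _ _ erefl erefl a0 aphi b erefl ha).
- by move=> r; rewrite -wE subrKC.
- by apply: smooth_on_sub sF => r /eW'[[]].
- by apply: smooth_on_sub sM => r /eW'[_ []].
- by apply: smooth_on_sub sw => r /eW'[].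
- by move=> r /eI[[]].
- by move=> r /eI[_ []].
- by move=> r /eI[].
- by apply: smooth_on_sub sp => r /eW'[_ _ _ _ []].
- by apply: smooth_on_sub sb => r /eW'[].
- by move=> r; rewrite -bE /b0 subrKC.
Qed.
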